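(* There is an algorithm that solves every connectivity game $\mathcal G=(V_0,V_1,E,\{V\})$, $V=V_0\cup V_1$, in time $O\big((\sqrt{|V_1|}+1)\,|E|+|V_1|^2\big)$.
   Context: Connectivity game: $V_0,V_1$ are disjoint finite sets, $V=V_0\cup V_1$, $E\subseteq (V_0\times V_1)\cup(V_1\times V_0)$. A token starts at some vertex; whenever the token is at $v\in V_\sigma$, player $\sigma\in\{0,1\}$ moves it along an edge of $E$ out of $v$. If a vertex with no outgoing edge is reached, player 1 wins. An infinite play is won by player 0 if every vertex of $V$ is visited infinitely often, and by player 1 otherwise. To solve the game means to find, given $V_0,V_1,E$, the sets $Win_0$ and $Win_1$ of starting vertices from which player 0, respectively player 1, has a winning strategy (equivalently, to decide whether player 0 wins from every vertex). Running time is worst-case time in the usual random-access model. *)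

(* Defs.v *)
From mathcomp Require Import all_boot.
Set Implicit Arguments.
Unset Strict Implicit.
Unset Printing Implicit Defensive.

(** * Connectivity games *)

(* The sum type is the disjoint union of the two vertex sets.  Players are
   booleans: false is player 0 and true is player 1. *)
Definition owner (A B : Type) (v : A + B) : bool :=
  if v is inr _ then true else false.

Record game := Game {
  V0 : finType;
  V1 : finType;
  edges : {set (V0 + V1) * (V0 + V1)};
  edges_bipartite : forall u v, (u, v) \in edges -> owner u != owner v
}.

Definition vertex (G : game) : finType := (V0 G + V1 G)%type.

Section Plays.
Variable G : game.
Implicit Types (x v : vertex G) (p : seq (vertex G)) (f : nat -> vertex G).

Definition edge : rel (vertex G) := fun u v => (u, v) \in edges G.

Definition dead_end v := forall u, ~~ edge v u.

(* A play from x: either x followed by finitely many further vertices, or an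
   infinite sequence of vertices. *)
Inductive play :=
| Finite of vertex G & seq (vertex G)
| Infinite of nat -> vertex G.

Definition maximal_play_from x (pi : play) : Prop :=
  match pi with
  | Finite y p => [/\ y = x, path edge y p & dead_end (last y p)]
  | Infinite f => f 0 = x /\ forall i, edge (f i) (f i.+1)
  end.

(* [s h v] is the move chosen at v, where h lists the vertices visited before
   the token arrived at v. *)
Definition strategy := seq (vertex G) -> vertex G -> vertex G.

(* Without this requirement a strategy prescribing illegal moves would have
   no maximal consistent play and would win vacuously. *)
Definition legal (sigma : bool) (s : strategy) : Prop :=
  forall h v, owner v = sigma -> ~ dead_end v -> edge v (s h v).

Definition consistent (sigma : bool) (s : strategy) (pi : play) : Prop :=
  match pi with
  | Finite y p => forall i, i < size p -> owner (nth y (y :: p) i) = sigma ->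
      nth y p i = s (take i (y :: p)) (nth y (y :: p) i)
  | Infinite f => forall i, owner (f i) = sigma ->
      f i.+1 = s (mkseq f i) (f i)
  end.

(* Used for maximal plays only: a finite one has reached a dead end. *)
Definition won_by0 (pi : play) : Prop :=
  match pi with
  | Finite _ _ => False
  | Infinite f => forall v n, exists2 m, n <= m & f m = v
  end.

Definition won_by (sigma : bool) (pi : play) : Prop :=
  if sigma then ~ won_by0 pi else won_by0 pi.

Definition winning_from (sigma : bool) (s : strategy) x : Prop :=
  legal sigma s /\
  forall pi, maximal_play_from x pi -> consistent sigma s pi ->
    won_by sigma pi.

Definition Win (sigma : bool) x : Prop :=
  exists s, winning_from sigma s x.

End Plays.

(** * Random-access machine *)

(* A random-access machine with words of w bits, unit-cost operations and
   structured control flow.  Registers are named by constants; memory cells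
   are addressed by computed words.  Arithmetic is modulo 2 ^ w, except that
   subtraction truncates at 0. *)
Inductive binop := Add | Sub | Mul | Lt | Eq.

Inductive expr :=
| Const of nat
| Reg of nat
| Read of expr
| Bin of binop & expr & expr.

Inductive cmd :=
| Skip
| Assign of nat & expr      (* register := expression *)
| Write of expr & expr      (* memory[first expression] := second *)
| Seq of cmd & cmd
| If of expr & cmd & cmd    (* nonzero means true *)
| While of expr & cmd.

Record state := State { regs : nat -> nat; mem : nat -> nat }.

Definition upd (f : nat -> nat) (i x : nat) : nat -> nat :=
  fun j => if j == i then x else f j.

Definition eval_binop (o : binop) (a b : nat) : nat :=
  match o with
  | Add => a + b
  | Sub => a - b
  | Mul => a * b
  | Lt => a < b
  | Eq => a == b
  end.

Fixpoint eval (w : nat) (s : state) (e : expr) : nat :=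
  match e with
  | Const c => c %% 2 ^ w
  | Reg r => regs s r
  | Read a => mem s (eval w s a)
  | Bin o a b => eval_binop o (eval w s a) (eval w s b) %% 2 ^ w
  end.

Fixpoint cost (e : expr) : nat :=
  match e with
  | Const _ | Reg _ => 1
  | Read a => (cost a).+1
  | Bin _ a b => (cost a + cost b).+1
  end.

(* [exec w c s t s']: started in state s, c halts in state s' after t steps.
   The rules are deterministic. *)
Inductive exec (w : nat) : cmd -> state -> nat -> state -> Prop :=
| ExecSkip s : exec w Skip s 1 s
| ExecAssign s r e :
    exec w (Assign r e) s (cost e).+1
      (State (upd (regs s) r (eval w s e)) (mem s))
| ExecWrite s a e :
    exec w (Write a e) s (cost a + cost e).+1
      (State (regs s) (upd (mem s) (eval w s a) (eval w s e)))
| ExecSeq s1 s2 s3 c1 c2 t1 t2 :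
    exec w c1 s1 t1 s2 -> exec w c2 s2 t2 s3 ->
    exec w (Seq c1 c2) s1 (t1 + t2) s3
| ExecIf s s' e c1 c2 t :
    exec w (if eval w s e != 0 then c1 else c2) s t s' ->
    exec w (If e c1 c2) s ((cost e).+1 + t) s'
| ExecWhileFalse s e c :
    eval w s e = 0 -> exec w (While e c) s (cost e).+1 s
| ExecWhileTrue s1 s2 s3 e c t1 t2 :
    eval w s1 e != 0 -> exec w c s1 t1 s2 -> exec w (While e c) s2 t2 s3 ->
    exec w (While e c) s1 ((cost e).+1 + t1 + t2) s3.

(** * Input and output *)

Section Encoding.
Variable G : game.

(* V0 is numbered 0, ..., #|V0| - 1 and V1 is numbered from #|V0| on. *)
Definition vertex_code (v : vertex G) : nat :=
  match v with
  | inl x => enum_rank x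
  | inr y => #|V0 G| + enum_rank y
  end.

(* |V0|, |V1|, |E|, followed by the edge list es. *)
Definition input_words (es : seq (vertex G * vertex G)) : seq nat :=
  [:: #|V0 G|, #|V1 G|, size es
    & flatten [seq [:: vertex_code e.1; vertex_code e.2] | e <- es]].

Definition initial_state (es : seq (vertex G * vertex G)) : state :=
  State (fun _ => 0) (nth 0 (input_words es)).

(* Words are long enough for numbers up to a fixed power of the input size,
   that is, w >= k * log2 (|V0| + |V1| + |E| + 2). *)
Definition word_size_ok (k w : nat) : Prop :=
  (#|V0 G| + #|V1 G| + #|edges G| + 2) ^ k <= 2 ^ w.

(* The pair (Win_0, Win_1) is always (V, empty) or (empty, V); it is output as
   the bit b in register 0.  The last clause matters only for empty V. *)
Definition solved_by (s : state) : Prop :=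
  exists b : bool,
    [/\ regs s 0 = b,
        forall v : vertex G, Win false v <-> b,
        forall v : vertex G, Win true v <-> ~~ b
      & (forall v : vertex G, Win false v) <-> b].

End Encoding.

(* Main.v *)
(** Player 0 wins from everywhere if she can force the token from every vertex
    to every other one: she then visits the vertices cyclically.  The algorithm
    keeps a partition of V_0 into classes whose members can be forced into one
    another.  Say that u in V_1 is forced into a class c if all its successors
    lie in c.  If no vertex forced into c has a predecessor outside c, then
    player 1 can keep the token away from c once it has left c, so player 0
    loses.  Otherwise some other class c' can be forced into c.  Going from c
    to c' again and again gives a path of classes, kept on a stack; when c' is
    already on the stack, all classes of the stack from c' to c can be forced
    into one another, and it is sound to merge c with the class below it.

    There are at most 2 |V_0| steps.  With the numbers of edges between each
    class and each vertex of V_1 in a table, a step costs O(|V_0| + |V_1|).  If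
    |V_0| > |V_1|, some vertex of V_0 is not the unique successor of a vertex of
    V_1, so that player 1 can avoid it.  Otherwise the total is
    O(|E| + |V_1|^2), which is below the required bound. *)
Require Import Defs.
From mathcomp Require Import all_boot all_order all_algebra.
From mathcomp Require Import reals.
From mathcomp Require Import zify.
From Stdlib Require Import Classical.
Import Order.TTheory GRing.Theory Num.Theory.

Set Implicit Arguments.
Unset Strict Implicit.
Unset Printing Implicit Defensive.

(* The memory of a state, not the membership predicate of ssrbool. *)
Local Notation mem := Defs.mem.

(** * Forcing and traps *)

Section Games.
Variable G : game.
Implicit Types (x y z v : vertex G) (f : nat -> vertex G).

Definition some_move v := odflt v [pick u | edge v u].

Lemma not_dead_end v : ~ dead_end v -> exists u, edge v u.
Proof.
move=> H; apply/existsP; case e: [exists u, edge v u] => //.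
by case: H => u; move/negbT/existsPn: e.
Qed.

Lemma some_move_edge v : ~ dead_end v -> edge v (some_move v).
Proof.
move/not_dead_end=> [u vu]; rewrite /some_move; case: pickP => //= E.
by rewrite E in vu.
Qed.

(** * Disjointness of the winning sets *)

Section TwoStrategies.
Variables (s0 s1 : strategy G) (x : vertex G).

Definition joint_move h v := if owner v then s1 h v else s0 h v.

Fixpoint joint_history n : seq (vertex G) * vertex G :=
  if n is n'.+1 then
    let: (h, v) := joint_history n' in (rcons h v, joint_move h v)
  else ([::], x).

Definition joint_play n := (joint_history n).2.

Lemma joint_historyE n : (joint_history n).1 = mkseq joint_play n.
Proof.
elim: n => // n IHn; rewrite mkseqS -IHn /joint_play /=.
by case: (joint_history n).
Qed.

Lemma joint_playS n :
  joint_play n.+1 = joint_move (mkseq joint_play n) (joint_play n).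
Proof.
by rewrite -joint_historyE /joint_play /=; case: (joint_history n).
Qed.

End TwoStrategies.

(** Let the two strategies play against each other. If no dead end is reached, the infinite play
    would be won by both players; otherwise the play cut at its first dead end is consistent with
    [s0] and yet not won by player 0. *)
Lemma Win_exclusive x : Win false x -> Win true x -> False.
Proof.
move=> [s0 [L0 W0]] [s1 [L1 W1]].
pose f := joint_play s0 s1 x.
have fS n : f n.+1 = joint_move s0 s1 (mkseq f n) (f n) by exact: joint_playS.
have step n : ~ dead_end (f n) -> edge (f n) (f n.+1).
  by rewrite fS /joint_move => D; case o: (owner (f n)); [apply: L1|apply: L0].
have [[n Dn]|D] := classic (exists n, dead_end (f n)); last first.
  have mx : maximal_play_from x (Infinite f).
    by split=> // i; apply: step => Di; apply: D; exists i.
  apply: (W1 _ mx); last apply: (W0 _ mx).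
  + by move=> i o; rewrite fS /joint_move o.
  + by move=> i o; rewrite fS /joint_move o.
have ex : exists n, [forall u, ~~ edge (f n) u] by exists n; apply/forallP.
(* Minimality of [k] keeps dead ends out of the earlier positions, so all moves before it follow
   edges. *)
case: (ex_minnP ex) => k /forallP Dk min_k.
pose p := mkseq (fun i => f i.+1) k.
have Ep : f 0 :: p = mkseq f k.+1.
  by rewrite /p /mkseq /= (iotaDl 1 0 k) -map_comp.
have sp : size p = k by rewrite size_mkseq.
have nthp i : i <= k -> nth (f 0) (f 0 :: p) i = f i.
  by move=> ik; rewrite Ep nth_mkseq.
have mx : maximal_play_from x (Defs.Finite (f 0) p).
  split=> //; last first.
    by rewrite (last_nth (f 0)) sp nthp.
  apply/(pathP (f 0)) => i; rewrite sp => ik.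
  rewrite nthp 1?ltnW // nth_mkseq //; apply: step => Di.
  have Di' : [forall u, ~~ edge (f i) u] by apply/forallP.
  by have := min_k i Di'; rewrite leqNgt ik.
apply: (W0 _ mx) => i; rewrite sp => ik.
rewrite nthp 1?ltnW // nth_mkseq // fS /joint_move => ->; congr (s0 _ _).
rewrite Ep /mkseq -map_take take_iota (minn_idPl _) //; lia.
Qed.

(* Staying in X whenever possible is a strategy of player 1 that keeps the
   token in X once it has got there, hence away from t. *)
Lemma trap_Win1 (X : {set vertex G}) t :
  t \notin X ->
  (forall x y, x \in X -> ~~ owner x -> edge x y -> y \in X) ->
  (forall x y, x \in X -> owner x -> edge x y ->
     exists2 y', edge x y' & y' \in X) ->
  (forall f, (forall i, edge (f i) (f i.+1)) -> won_by0 (Infinite f) ->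
     exists i, f i \in X) ->
  forall x, Win true x.
Proof.
move=> tX cl0 cl1 enters x.
pose s (h : seq (vertex G)) v :=
  odflt (some_move v) [pick y | edge v y && (y \in X)].
exists s; split=> [h v _ D|].
  by rewrite /s; case: pickP => [y /andP[]|_] //=; exact: some_move_edge.
(* A finite play is won by player 1 outright. An infinite play won by player 0 would enter [X] and
   visit [t] later, so it suffices that it never leaves [X]. *)
case=> [y p|f] [_ mx] cons won //.
have [i fi] := enters f mx won.
have [m im fm] := won t i.
suff : f m \in X by rewrite fm (negPf tX).
rewrite -(subnKC im); elim: (m - i) => [|d IHd]; first by rewrite addn0.
rewrite addnS; case o: (owner (f (i + d))); last first.
  by apply: cl0 IHd _ (mx _); rewrite o.
have := cons _ o; rewrite /s => ->.
case: pickP => [y /andP[]|none] //=.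
have [y' e y'X] := cl1 _ _ IHd o (mx _).
by have := none y'; rewrite e y'X.
Qed.

(* [attracts z n x]: from x, player 0 can force a visit to z within n moves. *)
Fixpoint attracts z n x : bool :=
  (x == z) ||
  if n is n'.+1 then
    if owner x then
      [exists y, edge x y] && [forall y, edge x y ==> attracts z n' y]
    else [exists y, edge x y && attracts z n' y]
  else false.

Definition forces x z := exists n, attracts z n x.

Lemma attractsS z n x : attracts z n x -> attracts z n.+1 x.
Proof.
elim: n x => [|n IHn] x; first by rewrite /= orbF => ->.
rewrite [attracts z n.+1 x]/= [attracts z n.+2 x]/=.
case: (x == z) => //=; case: (owner x).
  case/andP=> -> /forallP H; apply/forallP => y; apply/implyP => xy.
  by apply: (IHn y); apply: (implyP (H y)).
by case/existsP => y /andP[xy /IHn H]; apply/existsP; exists y; rewrite xy.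
Qed.

Lemma leq_attracts z m n x : m <= n -> attracts z m x -> attracts z n x.
Proof.
move=> mn H; rewrite -(subnKC mn); elim: (n - m) => [|d]; rewrite ?addn0 //.
by rewrite addnS; exact: attractsS.
Qed.

Lemma forces_refl x : forces x x.
Proof. by exists 0; rewrite /= eqxx. Qed.

Lemma forces_trans x y z : forces x y -> forces y z -> forces x z.
Proof.
move=> [m xy] [n yz]; exists (m + n); elim: m x xy => [|m IHm] x.
  by rewrite /= orbF => /eqP->.
have [->|ne] := eqVneq x y; first by move=> _; apply: leq_attracts yz; lia.
rewrite /= (negPf ne) /=; case: (x == z) => //=; case: (owner x).
  case/andP=> -> /forallP H; apply/forallP => v; apply/implyP => xv.
  by apply: IHm; apply: (implyP (H v)).
by case/existsP => v /andP[xv H]; apply/existsP; exists v; rewrite xv IHm.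
Qed.

Lemma forces_move0 x y : ~~ owner x -> edge x y -> forces x y.
Proof.
move=> /negPf o xy; exists 1; rewrite /= o; apply/orP; right.
by apply/existsP; exists y; rewrite xy eqxx.
Qed.

(** The successors come with different bounds on the number of moves; as there are finitely many,
    the maximum serves them all. A dead end is excluded because there the condition on successors
    would be vacuous. *)
Lemma forces_move1 x z : owner x -> ~ dead_end x ->
  (forall y, edge x y -> forces y z) -> forces x z.
Proof.
move=> o D H.
have H' y : exists n, edge x y -> attracts z n y.
  case e: (edge x y); last by exists 0.
  by have [n Hn] := H y e; exists n.
have [N HN] := fin_all_exists H'.
exists (\max_y N y).+1; rewrite /= o; apply/orP; right; apply/andP; split.
  by apply/existsP; exact: not_dead_end.
apply/forallP => y; apply/implyP => xy.
by apply: leq_attracts (HN y xy); exact: leq_bigmax.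
Qed.

(** Used to exclude dead ends: a visit elsewhere needs a first move. *)
Lemma forces_edge x y : forces x y -> x != y -> exists u, edge x u.
Proof.
move=> [[|n]] /=; first by rewrite orbF => ->.
move=> /orP[->//|+] _; case: (owner x); first by case/andP => /existsP.
by case/existsP => u /andP[]; exists u.
Qed.

(** * Visiting all vertices in cyclic order *)

Section Cycling.
Hypothesis forces_all : forall x z, forces x z.

(** The rank of [x] in the attractor of [z]. *)
Definition distance x z := ex_minn (forces_all x z).

Lemma distance_move1 x y z : x != z -> owner x -> edge x y ->
  distance y z < distance x z.
Proof.
move=> xz o xy; rewrite /distance.
case: (ex_minnP (forces_all x z)) => [[|n]]; first by rewrite /= (negPf xz).
rewrite /= (negPf xz) o /= => /andP[_ /forallP H] _.
by case: ex_minnP => m _; apply; apply: (implyP (H y)).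
Qed.

Lemma distance_move0 x z : x != z -> ~~ owner x ->
  exists2 y, edge x y & distance y z < distance x z.
Proof.
move=> xz /negPf o; rewrite /distance.
case: (ex_minnP (forces_all x z)) => [[|n]]; first by rewrite /= (negPf xz).
rewrite /= (negPf xz) o /= => /existsP[y /andP[xy H]] _; exists y => //.
by case: ex_minnP => m _; exact.
Qed.

Variable x0 : vertex G.

(* Player 0 visits all vertices in cyclic order: after history h, the current
   goal is the vertex numbered [goal_index h] modulo the number of vertices. *)
Definition goal k := nth x0 (enum (vertex G)) (k %% #|vertex G|).

Definition goal_index (h : seq (vertex G)) :=
  foldl (fun k v => k + (v == goal k)) 0 h.

Definition toward z x :=
  odflt (some_move x) [pick y | edge x y && (distance y z < distance x z)].

(** The current vertex is appended to the history because arriving there may complete the current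
    goal. *)
Definition cycling : strategy G :=
  fun h v => toward (goal (goal_index (rcons h v))) v.

Lemma cycling_legal : legal false cycling.
Proof.
move=> h v _ D; rewrite /cycling /toward.
by case: pickP => [y /andP[]|_] //=; exact: some_move_edge.
Qed.

Variable f : nat -> vertex G.
Hypothesis f_path : forall i, edge (f i) (f i.+1).
Hypothesis f_cycling : forall i, owner (f i) = false ->
  f i.+1 = cycling (mkseq f i) (f i).

Let index_at i := goal_index (mkseq f i.+1).

Lemma index_atS i :
  index_at i.+1 = index_at i + (f i.+1 == goal (index_at i)).
Proof. by rewrite {1}/index_at mkseqS /goal_index foldl_rcons. Qed.

Lemma distance_decreases i z : goal (index_at i) = z -> f i != z ->
  distance (f i.+1) z < distance (f i) z.
Proof.
move=> Ez iz; case o: (owner (f i)); first exact: distance_move1.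
have [y e ltd] := distance_move0 iz (negbT o).
rewrite f_cycling // /cycling -mkseqS -/(index_at i) Ez /toward.
by case: pickP => [v /andP[]|/(_ y)] //=; rewrite e ltd.
Qed.

Lemma goal_reached i :
  exists2 j, i < j & f j = goal (index_at i) /\ index_at j = (index_at i).+1.
Proof.
move Ek: (index_at i) => k.
(* As long as the goal is missed, the index stays the same and the distance to the goal drops, which
   allows induction on a bound for the distance. *)
have away n : forall j, index_at j = k -> f j != goal k ->
    distance (f j) (goal k) <= n ->
    exists2 l, j < l & f l = goal k /\ index_at l = k.+1.
  elim: n => [|n IHn] j Ej nj dj.
    by have := @distance_decreases j (goal k); rewrite Ej => /(_ erefl nj); lia.
  have := @distance_decreases j (goal k); rewrite Ej => /(_ erefl nj) dec.
  have := index_atS j; rewrite Ej.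
  have [fj|nj'] := eqVneq (f j.+1) (goal k) => E.
    by exists j.+1 => //; rewrite E addn1.
  rewrite addn0 in E.
  have [|l jl H] := IHn j.+1 E nj'; first lia.
  by exists l => //; lia.
(* The first move is treated separately: [f i] may itself be the next goal, and then the move need
   not decrease the distance. *)
have := index_atS i; rewrite Ek.
have [fi|ni'] := eqVneq (f i.+1) (goal k) => E.
  by exists i.+1 => //; rewrite E addn1.
rewrite addn0 in E; have [l il H] := away _ i.+1 E ni' (leqnn _).
by exists l => //; lia.
Qed.

Lemma index_unbounded d i :
  exists2 j, i <= j & index_at j = index_at i + d.
Proof.
elim: d => [|d [j ij E]]; first by exists i; rewrite ?addn0.
have [l jl [_ El]] := goal_reached j; exists l; first lia.
by rewrite El E addnS.
Qed.

Lemma cycling_wins : won_by0 (Infinite f).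
Proof.
move=> v n; pose q := index v (enum (vertex G)).
have qlt : q < #|vertex G| by rewrite cardE index_mem mem_enum.
(* The increment is chosen so that the new index is [index_at n * #|vertex G| + q], which is
   congruent to the position [q] of [v] in the enumeration. *)
have [j nj Ej] := index_unbounded (index_at n * #|vertex G|.-1 + q) n.
have [m jm [fm _]] := goal_reached j.
exists m; first lia.
rewrite fm Ej /goal.
have -> : index_at n + (index_at n * #|vertex G|.-1 + q)
          = index_at n * #|vertex G| + q.
  rewrite addnA -[X in X + _ + _]muln1 -mulnDr add1n prednK //; lia.
by rewrite modnMDl modn_small // nth_index // mem_enum.
Qed.

End Cycling.

(** The condition on dead ends matters for a single vertex, where the first hypothesis holds by
    reflexivity alone. *)
Lemma forces_all_Win0 : (forall x z, forces x z) ->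
  (forall x, ~ dead_end x) -> forall x, Win false x.
Proof.
move=> F D x; exists (cycling F x); split; first exact: cycling_legal.
case=> [y p [_ _ /D]//|f [_ mx] cons]; exact: (cycling_wins (x0 := x) mx cons).
Qed.

End Games.

(** * Cost-annotated execution rules *)

(* Evaluation without wrap-around; it agrees with [eval] when [fits] holds. *)
Fixpoint value (s : state) (e : expr) : nat :=
  match e with
  | Const c => c
  | Reg r => regs s r
  | Read a => mem s (value s a)
  | Bin o a b => eval_binop o (value s a) (value s b)
  end.

Fixpoint fits (W : nat) (s : state) (e : expr) : Prop :=
  match e with
  | Const c => c < W
  | Reg _ => True
  | Read a => fits W s a
  | Bin o a b =>
      [/\ fits W s a, fits W s b
        & match o with
          | Lt | Eq => 1 < W
          | _ => eval_binop o (value s a) (value s b) < W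
          end]
  end.

Lemma eval_value w s e : fits (2 ^ w) s e -> eval w s e = value s e.
Proof.
elim: e => [c|r|a IHa|o a IHa b IHb] //=.
- by move=> ?; rewrite modn_small.
- by move=> /IHa ->.
- case=> /IHa -> /IHb -> H; rewrite modn_small //.
  by case: o H => //= H; apply: leq_ltn_trans (leq_b1 _) H.
Qed.

(** A total-correctness triple with a time bound. The postcondition may itself be a [run], so that
    programs are verified by forward symbolic execution. *)
Definition run w c s T (Q : state -> Prop) :=
  exists t s', [/\ exec w c s t s', t <= T & Q s'].

Section Rules.
Variable w : nat.
Implicit Types (s : state) (Q : state -> Prop) (c : cmd).

Lemma run_le c s T0 T Q : run w c s T0 Q -> T0 <= T -> run w c s T Q.
Proof.
by move=> [t [s' [H tT q]]] TT; exists t, s'; split=> //; exact: leq_trans TT.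
Qed.

Lemma run_weaken c s T Q0 Q :
  run w c s T Q0 -> (forall s', Q0 s' -> Q s') -> run w c s T Q.
Proof. by move=> [t [s' [H tT q]]] QQ; exists t, s'; split=> //; exact: QQ. Qed.

Lemma run_skip s Q : Q s -> run w Skip s 1 Q.
Proof. by move=> q; exists 1, s; split=> //; exact: ExecSkip. Qed.

Lemma run_assign s r e Q : fits (2 ^ w) s e ->
  Q (State (upd (regs s) r (value s e)) (mem s)) ->
  run w (Assign r e) s (cost e).+1 Q.
Proof.
by move=> /eval_value <- q; do 2!eexists; split; [exact: ExecAssign| |].
Qed.

Lemma run_write s a e Q : fits (2 ^ w) s a -> fits (2 ^ w) s e ->
  Q (State (regs s) (upd (mem s) (value s a) (value s e))) ->
  run w (Write a e) s (cost a + cost e).+1 Q.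
Proof.
move=> /eval_value <- /eval_value <- q.
by do 2!eexists; split; [exact: ExecWrite| |].
Qed.

Lemma run_seq c1 c2 s T1 T2 Q :
  run w c1 s T1 (fun s1 => run w c2 s1 T2 Q) -> run w (Seq c1 c2) s (T1 + T2) Q.
Proof.
move=> [t1 [s1 [H1 le1 [t2 [s2 [H2 le2 q]]]]]].
exists (t1 + t2), s2; split=> //; first exact: ExecSeq H1 H2.
exact: leq_add.
Qed.

(** Adding the times of the branches keeps the bounds linear; an impossible branch can be given time
    0. *)
Lemma run_if e c1 c2 s T1 T2 Q : fits (2 ^ w) s e ->
  (value s e != 0 -> run w c1 s T1 Q) -> (value s e = 0 -> run w c2 s T2 Q) ->
  run w (If e c1 c2) s ((cost e).+1 + (T1 + T2)) Q.
Proof.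
move=> /eval_value Ee H1 H2.
have [t [s' [H tT q]]] :
    run w (if eval w s e != 0 then c1 else c2) s (T1 + T2) Q.
  rewrite Ee; case: eqP => E.
  - by apply: run_le (H2 E) _; rewrite leq_addl.
  - by apply: run_le (H1 _) _; [exact/eqP|rewrite leq_addr].
exists ((cost e).+1 + t), s'; split=> //; first exact: ExecIf.
by rewrite leq_add2l.
Qed.

(* The index of the invariant bounds the number of iterations left. *)
Lemma run_while e c s n Tb (I : nat -> state -> Prop) Q :
  (forall k s1, I k s1 -> fits (2 ^ w) s1 e) ->
  (forall k s1, I k s1 -> value s1 e != 0 ->
     run w c s1 Tb (fun s2 => exists2 l, l < k & I l s2)) ->
  (forall k s1, I k s1 -> value s1 e = 0 -> Q s1) ->
  I n s -> run w (While e c) s (n.+1 * (cost e).+1 + n * Tb) Q.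
Proof.
(* Strong induction, since an iteration may lower the index by more than one. *)
move=> F body done; elim: n {-2}n (leqnn n) s => [|n IHn] k kn s Ik.
  have k0 : k = 0 by lia.
  have /eqP e0 : value s e == 0.
    apply/negPn/negP => ne; have [t [s' [_ _ [l]]]] := body _ _ Ik ne; lia.
  exists (cost e).+1, s; split; [|lia|exact: done Ik e0].
  by apply: ExecWhileFalse; rewrite (eval_value (F _ _ Ik)).
have [e0|ne] := eqVneq (value s e) 0.
  exists (cost e).+1, s; split; [|nia|exact: done Ik e0].
  by apply: ExecWhileFalse; rewrite (eval_value (F _ _ Ik)).
have [t1 [s1 [H1 le1 [l lk Il]]]] := body _ _ Ik ne.
have [|t2 [s2 [H2 le2 q]]] := IHn l _ s1 Il; first lia.
exists ((cost e).+1 + t1 + t2), s2; split=> //; last nia.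
by apply: ExecWhileTrue H1 H2; rewrite (eval_value (F _ _ Ik)).
Qed.

End Rules.

Definition same_off (X : seq nat) (f g : nat -> nat) :=
  forall r, r \notin X -> g r = f r.

Lemma same_off_upd X f g r v :
  r \in X -> same_off X f g -> same_off X f (upd g r v).
Proof.
move=> rX H q qX; rewrite /upd; case: eqP => [E|_]; last exact: H.
by rewrite -E (negPf qX) in rX.
Qed.

Notation rOk := 0 (only parsing).
Notation rN0 := 1 (only parsing).
Notation rN1 := 2 (only parsing).
Notation rE := 3 (only parsing).
Notation rRow := 4 (only parsing).
Notation rI := 5 (only parsing).
Notation rA := 6 (only parsing).
Notation rB := 7 (only parsing).
Notation rClasses := 8 (only parsing).
Notation rTop := 9 (only parsing).
Notation rU := 10 (only parsing).
Notation rC := 11 (only parsing).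

Definition For b body :=
  Seq (Assign rI (Const 0))
    (While (Bin Lt (Reg rI) (Reg b))
       (Seq body (Assign rI (Bin Add (Reg rI) (Const 1))))).

(** The time consists of 2 for the initialisation, 4 for each of the [n + 1] tests, and [Tb + 4] for
    each body with its increment. The invariant is required only at the loop head, after the counter
    has been updated. *)
Lemma run_for w b n body s Tb (I : nat -> state -> Prop) Q :
  n < 2 ^ w -> 1 < 2 ^ w ->
  (forall i s1, I i s1 -> regs s1 b = n) ->
  I 0 (State (upd (regs s) rI 0) (mem s)) ->
  (forall i s1, i < n -> regs s1 rI = i -> I i s1 ->
     run w body s1 Tb (fun s2 => regs s2 rI = i /\
       I i.+1 (State (upd (regs s2) rI i.+1) (mem s2)))) ->
  (forall s1, I n s1 -> Q s1) ->
  run w (For b body) s (6 + n * (Tb + 8)) Q.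
Proof.
move=> nW W1 Ib I0 Ibody IQ.
eapply run_le; first eapply run_seq.
  eapply run_assign; first by rewrite /=; lia.
  apply: (run_while (n := n) (Tb := Tb + 4)
            (I := fun k s1 => [/\ k <= n, regs s1 rI = n - k & I (n - k) s1])).
  - by move=> k s1 _ /=; split.
  - move=> k s1 [kn Ei Ik] /=; rewrite Ei (Ib _ _ Ik) => ne.
    have lt : n - k < n by move: ne; case: ltnP.
    apply: run_seq; apply: run_weaken (Ibody _ _ lt Ei Ik) _ => s2 [E2 I2].
    eapply run_assign; first by rewrite /= E2; split=> //; lia.
    rewrite /= E2 addn1; exists k.-1; first lia.
    have -> : n - k.-1 = (n - k).+1 by lia.
    by split=> //; lia.
  - move=> k s1 [kn Ei Ik] /=; rewrite Ei (Ib _ _ Ik) => e0.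
    apply: IQ; have -> // : n = n - k by move: e0; case: ltnP; lia.
  - by rewrite subnn.
rewrite /=; nia.
Qed.

(** * The program *)

(* The memory is divided into rows of length rRow.  Row 0 holds the input.  For
   a class c, identified with its representative in V_0, the entries u of rows
   2 c + 1 and 2 c + 2 are the numbers of edges from u to c and from c to u;
   for c = |V_0| they are the degrees of u.  The entry c of row 2 |V_0| + 3 is 0
   if c is not on the stack, and otherwise 1 + the class below c (or just 1 at
   the bottom). *)
Definition cell j x := Bin Add (Bin Mul j (Reg rRow)) x.
Definition row d c := Bin Add (Bin Mul (Const 2) c) (Const d).
Notation out_row := (row 1).
Notation in_row := (row 2).
Notation below_row := (row 3 (Reg rN0)).

Definition increment a := Write a (Bin Add (Read a) (Const 1)).

(** The offsets 3 and 4 skip the three header words of the input. Each edge is counted twice: for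
    its end in [V0] and in the degree rows. *)
Definition read_edges :=
  For rE
    (Seq (Assign rA (Read (Bin Add (Bin Mul (Const 2) (Reg rI)) (Const 3))))
    (Seq (Assign rB (Read (Bin Add (Bin Mul (Const 2) (Reg rI)) (Const 4))))
    (If (Bin Lt (Reg rA) (Reg rN0))
      (Seq (Assign rB (Bin Defs.Sub (Reg rB) (Reg rN0)))
      (Seq (increment (cell (in_row (Reg rA)) (Reg rB)))
           (increment (cell (in_row (Reg rN0)) (Reg rB)))))
      (Seq (Assign rA (Bin Defs.Sub (Reg rA) (Reg rN0)))
      (Seq (increment (cell (out_row (Reg rB)) (Reg rA)))
           (increment (cell (out_row (Reg rN0)) (Reg rA)))))))).

Definition check_degrees :=
  Seq (Assign rOk (Const 1))
    (For rN1
      (Assign rOk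
        (Bin Mul (Reg rOk)
          (Bin Mul
            (Bin Lt (Const 0) (Read (cell (out_row (Reg rN0)) (Reg rI))))
            (Bin Lt (Const 0) (Read (cell (in_row (Reg rN0)) (Reg rI)))))))).

(** The value |V_1| in [rU] signals that no vertex was found. *)
Definition find_forced :=
  Seq (Assign rU (Reg rN1))
    (For rN1
      (If (Bin Mul
            (Bin Eq (Read (cell (out_row (Reg rTop)) (Reg rI)))
                    (Read (cell (out_row (Reg rN0)) (Reg rI))))
            (Bin Lt (Read (cell (in_row (Reg rTop)) (Reg rI)))
                    (Read (cell (in_row (Reg rN0)) (Reg rI)))))
         (Assign rU (Reg rI)) Skip)).

Definition find_class :=
  For rN0
    (If (Bin Mul
          (Bin Lt (Const 0) (Read (cell (in_row (Reg rI)) (Reg rU))))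
          (Bin Eq (Bin Eq (Reg rI) (Reg rTop)) (Const 0)))
       (Assign rC (Reg rI)) Skip).

(** The row of the absorbed class is cleared, so that [find_class] cannot select that class
    again. *)
Definition add_row d :=
  Seq (Write (cell (row d (Reg rB)) (Reg rI))
        (Bin Add (Read (cell (row d (Reg rB)) (Reg rI)))
                 (Read (cell (row d (Reg rTop)) (Reg rI)))))
      (Write (cell (row d (Reg rTop)) (Reg rI)) (Const 0)).

Definition merge_rows := For rN1 (Seq (add_row 1) (add_row 2)).

Definition push_class :=
  Seq (Write (cell below_row (Reg rC)) (Bin Add (Reg rTop) (Const 1)))
      (Assign rTop (Reg rC)).

(** A single level is popped even if the class found lies deeper in the stack; this already
    decreases [potential]. *)
Definition merge_top :=
  Seq (Assign rB (Bin Defs.Sub (Read (cell below_row (Reg rTop))) (Const 1)))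
  (Seq merge_rows
  (Seq (Assign rTop (Reg rB))
       (Assign rClasses (Bin Defs.Sub (Reg rClasses) (Const 1))))).

Definition contract_step :=
  Seq find_forced
    (If (Bin Lt (Reg rU) (Reg rN1))
      (Seq find_class
        (If (Read (cell below_row (Reg rC))) merge_top push_class))
      (Assign rOk (Const 0))).

Definition contract :=
  Seq (Assign rClasses (Reg rN0))
  (Seq (Assign rTop (Const 0))
  (Seq (Write (cell below_row (Reg rTop)) (Const 1))
  (While (Bin Mul (Reg rOk) (Bin Lt (Const 1) (Reg rClasses)))
    contract_step))).

(** Large enough for row 0 to hold the whole input of 2 |E| + 3 words and for the other rows to be
    indexed by [V0] or by [V1]. *)
Definition row_length :=
  Bin Mul (Const 2)
    (Bin Add (Bin Add (Reg rN0) (Reg rN1)) (Bin Add (Reg rE) (Const 2))).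

Definition solver :=
  Seq (Assign rN0 (Read (Const 0)))
  (Seq (Assign rN1 (Read (Const 1)))
  (If (Bin Lt (Reg rN1) (Reg rN0)) Skip
    (Seq (Assign rE (Read (Const 2)))
    (Seq (Assign rRow row_length)
    (Seq read_edges (Seq check_degrees contract)))))).

Ltac frame := rewrite /=; do ?[apply: same_off_upd; first by []]; by [].

(** * Time and effect of the subroutines *)

Section Loops.
Variables w n0 n1 m N : nat.
Hypothesis row_long : n0 + n1 + 2 * m + 4 <= N.
Hypothesis words_long : (2 * n0 + 4) * N <= 2 ^ w.
Implicit Types s : state.

Definition has_sizes s :=
  [/\ regs s rN0 = n0, regs s rN1 = n1, regs s rE = m & regs s rRow = N].

Definition tab s j x := mem s (j * N + x).

Lemma cell_eq j j' x x' : x < N -> x' < N ->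
  (j * N + x == j' * N + x') = (j == j') && (x == x').
Proof.
move=> xN xN'; apply/eqP/andP => [E|[/eqP-> /eqP->]] //.
have N0 : 0 < N := leq_ltn_trans (leq0n x) xN.
have := congr1 (divn ^~ N) E; have := congr1 (modn ^~ N) E.
by rewrite /= !modnMDl !divnMDl // !modn_small // !divn_small // !addn0 => -> ->.
Qed.

Lemma cell_fits j x : j <= 2 * n0 + 3 -> x < N -> j * N + x < 2 ^ w.
Proof. by move=> jn xN; apply: leq_trans words_long; nia. Qed.

Lemma row_fits : 4 * N <= 2 ^ w.
Proof. by apply: leq_trans words_long; nia. Qed.

(** All edges out of [u] lead into the class [c], and some edge into [u] comes from outside [c]. *)
Definition forced_from_outside s c u :=
  (tab s (2 * c + 1) u == tab s (2 * n0 + 1) u) &&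
  (tab s (2 * c + 2) u < tab s (2 * n0 + 2) u).

Lemma run_find_forced s c : has_sizes s -> regs s rTop = c -> c < n0 ->
  run w find_forced s (10 + n1 * 100) (fun s' =>
    [/\ same_off [:: rI; rU] (regs s) (regs s'), mem s' = mem s
      & (regs s' rU < n1 /\ forced_from_outside s c (regs s' rU)) \/
        (regs s' rU = n1 /\
         forall u, u < n1 -> ~~ forced_from_outside s c u)]).
Proof.
move=> [E0 E1 EE EN] Ec cn; have W := row_fits.
eapply run_le; first eapply run_seq.
  eapply run_assign => //.
  apply: (run_for (n := n1) (I := fun i s' =>
    [/\ same_off [:: rI; rU] (regs s) (regs s'), mem s' = mem s
      & (regs s' rU < n1 /\ forced_from_outside s c (regs s' rU)) \/
        (regs s' rU = n1 /\
         forall u, u < i -> ~~ forced_from_outside s c u)])).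
  - lia.
  - lia.
  - by move=> i s' [/(_ rN1 isT) -> _ _].
  - split=> //; first by frame.
    by right; split.
  - move=> i s' lt Ei [R M H].
    have := R rRow isT; have := R rTop isT; have := R rN0 isT.
    rewrite EN Ec E0 => R0 R9 R4.
    have F1 := @cell_fits (2 * c + 1) i; have F2 := @cell_fits (2 * c + 2) i.
    have F3 := @cell_fits (2 * n0 + 1) i; have F4 := @cell_fits (2 * n0 + 2) i.
    have g : value s' (Bin Mul
            (Bin Eq (Read (cell (out_row (Reg rTop)) (Reg rI)))
                    (Read (cell (out_row (Reg rN0)) (Reg rI))))
            (Bin Lt (Read (cell (in_row (Reg rTop)) (Reg rI)))
                    (Read (cell (in_row (Reg rN0)) (Reg rI)))))
          = forced_from_outside s c i.
      by rewrite /= R0 R9 R4 Ei M mulnb.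
    eapply run_if.
    + by rewrite /= R0 R9 R4 Ei /=; repeat split; lia.
    + rewrite g => gi; eapply run_assign => //; split=> //.
      split; [frame|by []|]; rewrite /= /upd /= Ei; left; split=> //.
      by move: gi; case: forced_from_outside.
    + rewrite g => gi; apply: run_skip; split=> //.
      split; [frame|by []|]; rewrite /= /upd /=.
      case: H => [|[H1 H2]]; [by left|right; split=> // u].
      rewrite ltnS leq_eqVlt => /predU1P[->|]; last exact: H2.
      by move: gi; case: forced_from_outside.
  - by [].
rewrite /=; nia.
Qed.

Lemma upd_cell f j j' x x' v : x < N -> x' < N ->
  upd f (j' * N + x') v (j * N + x) =
  if (x == x') && (j == j') then v else f (j * N + x).
Proof. by move=> xN xN'; rewrite /upd cell_eq // andbC. Qed.

Lemma run_find_class s c u : has_sizes s -> regs s rTop = c ->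
  regs s rU = u -> u < n1 ->
  (exists c', [/\ c' < n0, c' != c & 0 < tab s (2 * c' + 2) u]) ->
  run w find_class s (6 + n0 * 100) (fun s' =>
    [/\ same_off [:: rI; rC] (regs s) (regs s'), mem s' = mem s
      & let c' := regs s' rC in
        [/\ c' < n0, c' != c & 0 < tab s (2 * c' + 2) u]]).
Proof.
move=> [E0 E1 EE EN] Ec Eu un [c1 [c1n c1c c1u]]; have W := row_fits.
pose good c' := (0 < tab s (2 * c' + 2) u) && (c' != c).
eapply run_le.
  (* Since [rC] is not initialised, the invariant allows for no good class so far; at the end the
     class assumed to exist rules this out. *)
  apply: (run_for (n := n0) (I := fun i s' =>
    [/\ same_off [:: rI; rC] (regs s) (regs s'), mem s' = mem s
      & (regs s' rC < n0 /\ good (regs s' rC)) \/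
        (forall c', c' < i -> ~~ good c')])).
  - lia.
  - lia.
  - by move=> i s' [/(_ rN0 isT) -> _ _].
  - by split=> //; [frame|right].
  - move=> i s' lt Ei [R M H].
    have := R rRow isT; have := R rTop isT; have := R rU isT.
    rewrite EN Ec Eu => R0 R9 R4.
    have F1 := @cell_fits (2 * i + 2) u.
    have g : value s' (Bin Mul
          (Bin Lt (Const 0) (Read (cell (in_row (Reg rI)) (Reg rU))))
          (Bin Eq (Bin Eq (Reg rI) (Reg rTop)) (Const 0))) = good i.
      by rewrite /= R0 R9 R4 Ei M eqb0 mulnb.
    eapply run_if.
    + by rewrite /= R0 R9 R4 Ei /=; repeat split; lia.
    + rewrite g => gi; eapply run_assign => //; split=> //.
      split; [frame|by []|]; rewrite /= /upd /= Ei; left; split=> //.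
      by move: gi; case: (good i).
    + rewrite g => gi; apply: run_skip; split=> //.
      split; [frame|by []|]; rewrite /= /upd /=.
      case: H => [|H2]; [by left|right=> c'].
      rewrite ltnS leq_eqVlt => /predU1P[->|]; last exact: H2.
      by move: gi; case: (good i).
  - move=> s' [R M H]; split=> //; case: H => [[? /andP[]]|/(_ _ c1n)] //.
    by rewrite /good c1u c1c.
rewrite /=; nia.
Qed.

Lemma run_add_row d s i a b : has_sizes s -> d <= 2 ->
  regs s rI = i -> i < n1 -> regs s rTop = a -> a < n0 ->
  regs s rB = b -> b < n0 -> a != b ->
  tab s (2 * b + d) i + tab s (2 * a + d) i < 2 ^ w ->
  run w (add_row d) s 42 (fun s' => regs s' = regs s /\
    forall j x, x < N -> tab s' j x =
      if (x == i) && (j == 2 * b + d) then tab s j x + tab s (2 * a + d) x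
      else if (x == i) && (j == 2 * a + d) then 0 else tab s j x).
Proof.
move=> [E0 E1 EE EN] d2 Ei lti Ea lta Eb ltb ab bound; have W := row_fits.
have F1 := @cell_fits (2 * b + d) i; have F2 := @cell_fits (2 * a + d) i.
rewrite /tab in bound.
eapply run_le; first eapply run_seq.
  eapply run_write.
  - by rewrite /= EN Eb Ei; repeat split; lia.
  - by rewrite /= EN Eb Ei Ea; repeat split; lia.
  eapply run_write.
  - by rewrite /= EN Ea Ei; repeat split; lia.
  - by rewrite /=; lia.
  split=> // j x xN; rewrite /tab /= EN Ea Eb Ei !upd_cell //; try lia.
  case: eqP => [->|] //=; case: eqP => [->|] //=; first by case: eqP => //; lia.
  by case: eqP => [->|].
by [].
Qed.

(** If [j] is one of the two rows of [b], then [j + 2 * a - 2 * b] is the corresponding row of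
    [a]. *)
Lemma run_merge_rows s a b : has_sizes s -> regs s rTop = a -> a < n0 ->
  regs s rB = b -> b < n0 -> a != b ->
  (forall d i, 0 < d <= 2 -> i < n1 ->
     tab s (2 * b + d) i + tab s (2 * a + d) i < 2 ^ w) ->
  run w merge_rows s (6 + n1 * 100) (fun s' =>
    same_off [:: rI] (regs s) (regs s') /\
    forall j x, x < N -> tab s' j x =
      if (x < n1) && ((j == 2 * b + 1) || (j == 2 * b + 2))
      then tab s j x + tab s (j + 2 * a - 2 * b) x
      else if (x < n1) && ((j == 2 * a + 1) || (j == 2 * a + 2)) then 0
      else tab s j x).
Proof.
move=> sz Ea lta Eb ltb ab bound; have W := row_fits.
have [E0 E1 EE EN] := sz.
eapply run_le.
  apply: (run_for (n := n1) (I := fun i s' =>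
    same_off [:: rI] (regs s) (regs s') /\
    forall j x, x < N -> tab s' j x =
      if (x < i) && ((j == 2 * b + 1) || (j == 2 * b + 2))
      then tab s j x + tab s (j + 2 * a - 2 * b) x
      else if (x < i) && ((j == 2 * a + 1) || (j == 2 * a + 2)) then 0
      else tab s j x)).
  - lia.
  - lia.
  - by move=> i s' [/(_ rN1 isT) ->].
  - by split=> //; frame.
  - move=> i s1 lt Ei [R T].
    have sz1 : has_sizes s1 by split; rewrite R.
    have iN : i < N by lia.
    have R7 := R rB isT; have R9 := R rTop isT; rewrite Ea Eb in R7 R9.
    have Ta d : tab s1 (2 * a + d) i = tab s (2 * a + d) i.
      by rewrite T // ltnn.
    have Tb d : tab s1 (2 * b + d) i = tab s (2 * b + d) i.
      by rewrite T // ltnn.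
    eapply run_seq; eapply run_weaken.
      by apply: (@run_add_row 1 s1 i a b); rewrite ?R7 ?R9 ?Ta ?Tb //; exact: bound.
    move=> s2 [R2 T2]; eapply run_weaken.
      apply: (@run_add_row 2 s2 i a b); rewrite ?R2 ?R7 ?R9 //.
      + by rewrite /has_sizes R2.
      + rewrite !T2 // eqxx /=.
        (* Rows for [d = 1] and for [d = 2] differ in parity, so the first addition has left the
           rows of the second one untouched. *)
        do ![rewrite (_ : (_ == _) = false); last by lia].
        by rewrite Ta Tb; exact: bound.
    move=> s3 [R3 T3]; split; first by rewrite R3 R2.
    split; first by rewrite R3 R2; frame.
    move=> j x xN; rewrite /tab /= -!/(tab _ _ _) T3 // !T2 // !T // ltnS.
    have [->|ne] := eqVneq x i.
      rewrite ltnn leqnn /=.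
      have eqF (p q : nat) : p <> q -> (p == q) = false by move/eqP/negPf.
      rewrite (eqF (2 * a + 2)) ?(eqF (2 * a + 2) (2 * a + 1)); try lia.
      have [->|n2] := eqVneq j (2 * b + 2).
        rewrite !(eqF (2 * b + 2)); try lia.
        by rewrite orbT; congr (_ + tab s _ i); lia.
      have [->|n1'] := eqVneq j (2 * b + 1).
        rewrite !(eqF (2 * b + 1)); try lia.
        by rewrite /=; congr (_ + tab s _ i); lia.
      by rewrite /=; do 2!case: eqP.
    by rewrite /= (leq_eqVlt x) (negPf ne).
  - by [].
rewrite /=; nia.
Qed.

Lemma run_increment s a j x : value s a = j * N + x -> fits (2 ^ w) s a ->
  x < N -> tab s j x + 1 < 2 ^ w ->
  run w (increment a) s (cost a + (cost a).+3).+1 (fun s' =>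
    regs s' = regs s /\ forall j' x', x' < N ->
      tab s' j' x' = tab s j' x' + ((x' == x) && (j' == j))).
Proof.
move=> Ea Fa xN lt; have W := row_fits.
eapply run_le; first eapply run_write => //.
  by rewrite /= Ea; split => //; lia.
- split=> // j' x' x'N; rewrite /tab /= Ea upd_cell //.
  by case: eqP => [->|] /=; [case: eqP => [->|] //=|]; rewrite addn0.
by rewrite /=; lia.
Qed.

(** The two summands in each case are the two increments made for [e]: in the row of a class and in
    a degree row. *)
Definition contribution (e : nat * nat) j x : nat :=
  if e.1 < n0 then (x == e.2 - n0) * ((j == 2 * e.1 + 2) + (j == 2 * n0 + 2))
  else (x == e.1 - n0) * ((j == 2 * e.2 + 1) + (j == 2 * n0 + 1)).

Definition valid_edge (e : nat * nat) :=
  if e.1 < n0 then n0 <= e.2 < n0 + n1 else (e.1 < n0 + n1) && (e.2 < n0).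

(** Counting never touches row 0, so the edges still to be read stay intact. *)
Lemma contribution0 e x : contribution e 0 x = 0.
Proof. by rewrite /contribution !addn1 !addn2 /= !muln0 if_same. Qed.

Lemma sum_contribution_le es j x :
  \sum_(e <- es) contribution e j x <= 2 * size es.
Proof.
apply: (@leq_trans (\sum_(e <- es) 2)); last first.
  by rewrite big_const_seq count_predT iter_addn_0.
apply: leq_sum => e _.
rewrite /contribution; case: ifP => _; do 3!case: (_ == _) => //.
Qed.

Lemma run_read_edges s es : has_sizes s -> size es = m ->
  (forall i, i < m -> tab s 0 (2 * i + 3) = (nth (0, 0) es i).1) ->
  (forall i, i < m -> tab s 0 (2 * i + 4) = (nth (0, 0) es i).2) ->
  all valid_edge es ->
  (forall j x, 0 < j -> x < N -> tab s j x = 0) ->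
  run w read_edges s (6 + m * 150) (fun s' =>
    same_off [:: rI; rA; rB] (regs s) (regs s') /\
    forall j x, 0 < j -> x < N ->
      tab s' j x = \sum_(e <- es) contribution e j x).
Proof.
move=> [E0 E1 EE EN] Em in1 in2 /allP valid zero; have W := row_fits.
eapply run_le.
  apply: (run_for (n := m) (I := fun i s' =>
    same_off [:: rI; rA; rB] (regs s) (regs s') /\
    forall j x, x < N ->
      tab s' j x = tab s j x + \sum_(e <- take i es) contribution e j x)).
  - lia.
  - lia.
  - by move=> i s' [/(_ rE isT) ->].
  - by split; [frame|move=> j x _; rewrite take0 big_nil addn0].
  - move=> i s1 lt Ei [R T].
    have R0 := R rN0 isT; have R4 := R rRow isT; rewrite E0 EN in R0 R4.
    have low x : x < N -> mem s1 x = mem s x.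
      move=> xN; have := T 0 x xN; rewrite /tab mul0n add0n => ->.
      by rewrite big1 ?addn0 // => e _; exact: contribution0.
    have small j x : 0 < j -> x < N -> tab s1 j x + 2 < 2 ^ w.
      move=> j0 xN; rewrite T // zero // add0n.
      have := sum_contribution_le (take i es) j x.
      by rewrite size_take Em lt; lia.
    set e := nth (0, 0) es i.
    have ve : valid_edge e by apply: valid; rewrite mem_nth // Em.
    have Tn s2 : (forall j x, x < N ->
        tab s2 j x = tab s1 j x + contribution e j x) ->
        forall j x, x < N -> tab s2 j x =
          tab s j x + \sum_(e <- take i.+1 es) contribution e j x.
      move=> H j x xN; rewrite H // T // -addnA (take_nth (0, 0)) ?Em //.
      by rewrite -cats1 big_cat /= big_seq1.
    eapply run_seq; eapply run_assign; first by rewrite /= Ei; repeat split; lia.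
    eapply run_seq; eapply run_assign.
      by rewrite /= /upd /= Ei; repeat split; lia.
    rewrite /= /upd /= Ei !low; try lia.
    have := in1 i lt; have := in2 i lt; rewrite /tab !mul0n !add0n -/e => -> ->.
    have iN x : x < n1 -> x < N by lia.
    have F1 j x := @cell_fits j x.
    eapply run_if; first by rewrite /=; split=> //; lia.
    + rewrite /= /upd /= R0 => lt1; have {lt1} lt1 : e.1 < n0 by case: ltnP lt1.
      move: (ve); rewrite /valid_edge lt1 => ve2.
      eapply run_seq; eapply run_assign; first by rewrite /= /upd /= R0; repeat split; lia.
      rewrite /= /upd /= R0.
      have xN : e.2 - n0 < N by lia.
      have Fa := F1 (2 * e.1 + 2) _ _ xN; have Fb := F1 (2 * n0 + 2) _ _ xN.
      eapply run_seq; eapply run_weaken.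
        apply: (@run_increment _ _ (2 * e.1 + 2) (e.2 - n0)) => //.
        * by rewrite /= R4.
        * by rewrite /= R4; repeat split; lia.
        * by have := small (2 * e.1 + 2) _ _ xN; rewrite /tab /=; lia.
      move=> s2 [R2 T2]; eapply run_weaken.
        apply: (@run_increment _ _ (2 * n0 + 2) (e.2 - n0)) => //.
        * by rewrite /= R2 /= R0 R4.
        * by rewrite /= R2 /= R0 R4; repeat split; lia.
        * rewrite T2 //; have := small (2 * n0 + 2) _ _ xN.
          by rewrite /tab /=; case: (_ && _); lia.
      move=> s3 [R3 T3]; rewrite R3 R2; split=> //=; split; first frame.
      apply: Tn => j x xN'; rewrite /tab /= -!/(tab _ _ _) T3 // T2 //.
      rewrite /tab /= /contribution lt1 -addnA; congr (_ + _).
      by case: (x == _); rewrite ?mul1n.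
    + rewrite /= /upd /= R0 => lt1; have {lt1} lt1 : n0 <= e.1 by case: ltnP lt1.
      move: (ve); rewrite /valid_edge ltnNge lt1 /= => ve2.
      eapply run_seq; eapply run_assign; first by rewrite /= /upd /= R0; repeat split; lia.
      rewrite /= /upd /= R0.
      have xN : e.1 - n0 < N by lia.
      have Fa := F1 (2 * e.2 + 1) _ _ xN; have Fb := F1 (2 * n0 + 1) _ _ xN.
      eapply run_seq; eapply run_weaken.
        apply: (@run_increment _ _ (2 * e.2 + 1) (e.1 - n0)) => //.
        * by rewrite /= R4.
        * by rewrite /= R4; repeat split; lia.
        * by have := small (2 * e.2 + 1) _ _ xN; rewrite /tab /=; lia.
      move=> s2 [R2 T2]; eapply run_weaken.
        apply: (@run_increment _ _ (2 * n0 + 1) (e.1 - n0)) => //.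
        * by rewrite /= R2 /= R0 R4.
        * by rewrite /= R2 /= R0 R4; repeat split; lia.
        * rewrite T2 //; have := small (2 * n0 + 1) _ _ xN.
          by rewrite /tab /=; case: (_ && _); lia.
      move=> s3 [R3 T3]; rewrite R3 R2; split=> //=; split; first frame.
      apply: Tn => j x xN'; rewrite /tab /= -!/(tab _ _ _) T3 // T2 //.
      rewrite /tab /= /contribution ltnNge lt1 -addnA; congr (_ + _).
      by case: (x == _); rewrite ?mul1n.
  - by move=> s1 [R T]; split=> // j x j0 xN; rewrite T // zero // take_oversize // Em.
rewrite /=; lia.
Qed.

Lemma run_check_degrees s : has_sizes s ->
  run w check_degrees s (20 + n1 * 60) (fun s' =>
    [/\ same_off [:: rI; rOk] (regs s) (regs s'), mem s' = mem s
      & exists ok : bool, regs s' rOk = ok /\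
        (ok <-> forall u, u < n1 ->
                   0 < tab s (2 * n0 + 1) u /\ 0 < tab s (2 * n0 + 2) u)]).
Proof.
move=> [E0 E1 EE EN]; have W := row_fits.
eapply run_le; first eapply run_seq.
  eapply run_assign; first by rewrite /=; lia.
  apply: (run_for (n := n1) (I := fun i s' =>
    [/\ same_off [:: rI; rOk] (regs s) (regs s'), mem s' = mem s
      & exists ok : bool, regs s' rOk = ok /\
        (ok <-> forall u, u < i ->
                   0 < tab s (2 * n0 + 1) u /\ 0 < tab s (2 * n0 + 2) u)])).
  - lia.
  - lia.
  - by move=> i s' [/(_ rN1 isT) -> _ _].
  - by split=> //; [frame|exists true].
  - move=> i s' lt Ei [R M [ok [Eok okP]]].
    have R0 := R rN0 isT; have R4 := R rRow isT; rewrite E0 EN in R0 R4.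
    have F1 := @cell_fits (2 * n0 + 1) i; have F2 := @cell_fits (2 * n0 + 2) i.
    have b1 (b : bool) : b < 2 ^ w by apply: leq_ltn_trans (leq_b1 b) _; lia.
    eapply run_assign.
      rewrite /= R0 R4 Ei Eok; repeat split=> //; try lia; by rewrite !mulnb b1.
    rewrite /= R0 R4 Ei Eok M; split=> //; split; [frame|by []|].
    rewrite /= /upd /=.
    exists [&& ok, 0 < tab s (2 * n0 + 1) i & 0 < tab s (2 * n0 + 2) i].
    split; first by rewrite !mulnb.
    split=> [/and3P[/okP H1 H2 H3] u|H].
      by rewrite ltnS leq_eqVlt => /predU1P[-> //|]; exact: H1.
    have [H2 H3] := H i (leqnn _); apply/and3P; split=> //.
    by apply/okP => u ui; apply: H; lia.
  - by [].
by rewrite /=; lia.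
Qed.

(* How one contraction step changes the classes: [c] is the top class, [c'] a
   class from which player 0 can move to a vertex forced into [c]. *)
Variant step_spec s c s' : Prop :=
| StepStuck of mem s' = mem s & regs s' rOk = 0
    & (forall u, u < n1 -> ~~ forced_from_outside s c u)
| StepPush c' u of u < n1 & forced_from_outside s c u & c' < n0 & c' != c
    & 0 < tab s (2 * c' + 2) u & tab s (2 * n0 + 3) c' = 0
    & regs s' rOk = regs s rOk & regs s' rTop = c'
    & regs s' rClasses = regs s rClasses
    & (forall j x, x < N -> tab s' j x =
         if (x == c') && (j == 2 * n0 + 3) then c + 1 else tab s j x)
| StepMerge c' u of u < n1 & forced_from_outside s c u & c' < n0 & c' != c
    & 0 < tab s (2 * c' + 2) u & tab s (2 * n0 + 3) c' != 0
    & regs s' rOk = regs s rOk & regs s' rTop = (tab s (2 * n0 + 3) c).-1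
    & regs s' rClasses = (regs s rClasses).-1
    & (let b := (tab s (2 * n0 + 3) c).-1 in
       forall j x, x < N -> tab s' j x =
         if (x < n1) && ((j == 2 * b + 1) || (j == 2 * b + 2))
         then tab s j x + tab s (j + 2 * c - 2 * b) x
         else if (x < n1) && ((j == 2 * c + 1) || (j == 2 * c + 2)) then 0
         else tab s j x).

(** The hypotheses isolate what is needed from the game: the search for a class succeeds, a merge
    has a target other than [c], and no sum overflows. *)
Lemma run_contract_step s c : has_sizes s -> regs s rTop = c -> c < n0 ->
  (forall u, u < n1 -> forced_from_outside s c u ->
     exists c', [/\ c' < n0, c' != c & 0 < tab s (2 * c' + 2) u]) ->
  (forall u c', u < n1 -> forced_from_outside s c u -> c' < n0 -> c' != c ->
     0 < tab s (2 * c' + 2) u -> tab s (2 * n0 + 3) c' != 0 ->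
     (tab s (2 * n0 + 3) c).-1 < n0 /\ (tab s (2 * n0 + 3) c).-1 != c) ->
  (forall d u c1 c2, 0 < d <= 2 -> u < n1 -> c1 < n0 -> c2 < n0 -> c1 != c2 ->
     tab s (2 * c1 + d) u + tab s (2 * c2 + d) u < 2 ^ w) ->
  tab s (2 * n0 + 3) c < 2 ^ w -> regs s rClasses < 2 ^ w ->
  run w contract_step s (100 + (n0 + n1) * 300) (fun s' =>
    has_sizes s' /\ step_spec s c s').
Proof.
move=> sz Ec cn ex_class below_ok sums below_small classes_small.
have [E0 E1 EE EN] := sz; have W := row_fits.
eapply run_le; first eapply run_seq.
  eapply run_weaken; first exact: run_find_forced sz Ec cn.
  move=> s1 [R1 M1 found].
  have sz1 : has_sizes s1 by split; rewrite R1.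
  have T1 j x : tab s1 j x = tab s j x by rewrite /tab M1.
  have Ec1 : regs s1 rTop = c by rewrite R1.
  have E11 : regs s1 rN1 = n1 by rewrite R1.
  eapply run_if; first by rewrite /=; split=> //; lia.
  - rewrite /= E11 eqb0 negbK => lt.
    have {found} [_ forced] : regs s1 rU < n1 /\
        forced_from_outside s c (regs s1 rU) by case: found => // -[]; lia.
    eapply run_seq; eapply run_weaken.
      apply: (@run_find_class s1 c (regs s1 rU)) => //.
      by have [c' [? ? ?]] := ex_class _ lt forced; exists c'; rewrite T1.
    move=> s2 [R2 M2]; set c' := regs s2 rC => -[c'n c'c].
    rewrite T1 => c'u.
    have T2 j x : tab s2 j x = tab s j x by rewrite /tab M2 M1.
    have R20 : regs s2 rN0 = n0 by rewrite R2 // R1.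
    have R24 : regs s2 rRow = N by rewrite R2 // R1.
    have R29 : regs s2 rTop = c by rewrite R2.
    have F3 x := @cell_fits (2 * n0 + 3) x (leqnn _).
    eapply run_if.
    + rewrite /= R20 R24 -/c'; have := F3 c'; repeat split => //; lia.
    + rewrite /= R20 R24 -/c' -/(tab s2 (2 * n0 + 3) c') T2 => on_stack.
      have [bn bc] := below_ok _ _ lt forced c'n c'c c'u on_stack.
      eapply run_seq; eapply run_assign.
        rewrite /= R20 R24 R29 -/(tab s2 (2 * n0 + 3) c) T2.
        by have := F3 c; repeat split => //; lia.
      rewrite /= R20 R24 R29 -/(tab s2 (2 * n0 + 3) c) T2 subn1.
      set b := _.-1 in bn bc *.
      eapply run_seq; eapply run_weaken.
        apply: (@run_merge_rows _ c b) => //.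
        * by split; rewrite /= /upd /= R2 // R1.
        * by rewrite eq_sym.
        * by move=> d i d2 lti; rewrite /tab /= -!/(tab s2 _ _) !T2; apply: sums.
      move=> s3 [R3 T3].
      eapply run_seq; eapply run_assign => //.
      eapply run_assign.
        rewrite /= /upd /= R3 //= /upd /= R2 // R1 //; repeat split=> //; lia.
      split.
        by split; rewrite /= /upd /= R3 //= /upd /= R2 // R1.
      apply: (StepMerge (c' := c') (u := regs s1 rU)) => //;
        rewrite /= /upd /= ?R3 //= /upd /= ?R2 ?R1 // ?subn1 //.
      move=> j x xN; rewrite -!/b -!T2; exact: (T3 j x xN).
    + rewrite /= R20 R24 -/c' -/(tab s2 (2 * n0 + 3) c') T2 => off_stack.
      eapply run_seq; eapply run_write.
      * rewrite /= R20 R24 -/c'; have := F3 c'; repeat split => //; lia.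
      * by rewrite /= R29; repeat split => //; lia.
      eapply run_assign => //; split.
        by split; rewrite /= /upd /= R2 // R1.
      apply: (StepPush (c' := c') (u := regs s1 rU)) => //;
        try by rewrite /= /upd /= R2 // R1.
      move=> j x xN; rewrite /tab /= R20 R24 R29 -/c' upd_cell //; last lia.
      by have := T2 j x; rewrite /tab => ->.
  - rewrite /= E11 => /eqP; rewrite eqb0 -leqNgt => ge.
    eapply run_assign; first by rewrite /=; lia.
    split; first by split; rewrite /= /upd /= R1.
    by apply: StepStuck => //; case: found => [[]|[]] //; lia.
by rewrite /=; lia.
Qed.

End Loops.

(** * Correctness *)

Section Counting.
Variables (T : finType) (P : pred T) (Q : T -> bool).

Lemma sum_split : \sum_x Q x = \sum_(x | P x) Q x + \sum_(x | ~~ P x) Q x.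
Proof. exact: bigID. Qed.

Lemma sum_gt0P : reflect (exists2 x, P x & Q x) (0 < \sum_(x | P x) Q x).
Proof.
rewrite lt0n sum_nat_eq0; apply: (iffP idP) => [/forallPn[x]|[x Px Qx]].
  by rewrite negb_imply eqb0 negbK => /andP[]; exists x.
by apply/forallPn; exists x; rewrite Px Qx.
Qed.

End Counting.

(** * Sufficient conditions for player 1 to win everywhere *)

Section Losing.
Variable G : game.
Implicit Types (x y c : V0 G) (u : V1 G).

(** The number [d] matches the row offsets of the table: 1 for edges out of [u], 2 for edges into
    [u]. *)
Definition has_arc (d : nat) u x : bool :=
  if d == 1 then edge (inr u : vertex G) (inl x) else edge (inl x : vertex G) (inr u).

Definition degree d u := \sum_x has_arc d u x.

Definition positive_degrees := forall u, 0 < degree 1 u /\ 0 < degree 2 u.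

(** A vertex is demanded because on the empty game player 0 wins from everywhere vacuously, and the
    output bit must then be 1. *)
Definition lost := inhabited (vertex G) /\ forall v : vertex G, Win true v.

Lemma edge_owner (v v' : vertex G) : edge v v' -> owner v != owner v'.
Proof. exact: edges_bipartite. Qed.

Lemma degree_gt0P d u : reflect (exists x, has_arc d u x) (0 < degree d u).
Proof. by apply: (iffP (sum_gt0P _ _)) => [[x _]|[x]]; exists x. Qed.

(** A play won by player 0 visits [u] at a positive time, hence uses an edge into [u] and an edge
    out of it. As no such play exists, the empty set serves as the trap. *)
Lemma lost_isolated d u : 0 < d <= 2 -> degree d u = 0 -> lost.
Proof.
move=> d2 d0; split; first exact: (inhabits (inr u)).
have none x : has_arc d u x = false.
  apply/negP => ux; have : 0 < degree d u by apply/degree_gt0P; exists x.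
  by rewrite d0.
apply: (@trap_Win1 _ set0 (inr u)) => [|x y|x y|f path won]; rewrite ?inE //.
exfalso; have [n n0 fn] := won (inr u) 1.
have [d1|d1] := eqVneq d 1.
  have := path n; case fS : (f n.+1) => [x|u'].
    by rewrite fn; have := none x; rewrite /has_arc d1 eqxx => ->.
  by move/edge_owner; rewrite fn.
have := path n.-1; rewrite prednK // fn; case: (f n.-1) => [x|u'].
  by have := none x; rewrite /has_arc (negPf d1) => ->.
by move/edge_owner.
Qed.

(** If every vertex of [V0 G] were the only successor of some vertex of [V1 G], choosing the latter
    would inject [V0 G] into [V1 G]. So some [x] is nobody's only successor, and the complement of
    [x] is a trap. *)
Lemma lost_pigeonhole : #|V1 G| < #|V0 G| -> lost.
Proof.
move=> lt.
have [x0 _] : exists x0 : V0 G, true.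
  by have /card_gt0P[x _] : 0 < #|V0 G| by lia; exists x.
split; first exact: (inhabits (inl x0)).
pose only u x := has_arc 1 u x && [forall y, has_arc 1 u y ==> (y == x)].
have [x no_only] : exists x, [forall u, ~~ only u x].
  apply/existsP; apply: contraTT lt => /existsPn H; rewrite -leqNgt.
  have H' x : exists u, only u x.
    by have /forallPn[u] := H x; rewrite negbK; exists u.
  have [g Hg] := fin_all_exists H'.
  apply: (@leq_card _ _ g) => x y E.
  have /andP[ax _] := Hg x; have /andP[_ /forallP Hy] := Hg y.
  by apply/eqP; apply: (implyP (Hy x)); rewrite -E.
apply: (@trap_Win1 _ (~: [set inl x]) (inl x)); first by rewrite !inE eqxx.
- move=> [y|u] v _ //= _ /edge_owner; rewrite !inE.
  by case: v.
- move=> [//|u] [y|u'] _ _ uy; last by have := edge_owner uy.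
  have [E|ne] := eqVneq y x; last by exists (inl y); rewrite ?inE.
  have /forallP/(_ u) := no_only; rewrite /only /has_arc /= -E uy /=.
  case/forallPn => y'; rewrite negb_imply => /andP[uy' ne].
  by exists (inl y'); rewrite ?inE // -E.
(* Owners alternate, so one of the first two vertices lies in [V1 G] and hence in the trap. *)
- move=> f path _; have := edge_owner (path 0).
  case E0 : (f 0) => [y|u]; last by exists 0; rewrite E0 !inE.
  by case E1 : (f 1) => [y'|u] // _; exists 1; rewrite E1 !inE.
Qed.

(** The trap consists of the vertices of [V0 G] outside the class [c] and the vertices of [V1 G]
    with a successor outside it. Player 0 cannot leave it: a vertex she reaches from outside [c] has
    a predecessor outside [c], so it is not forced into [c]. *)
Lemma lost_stuck (cl : V0 G -> V0 G) c y : cl c = c -> cl y != c ->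
  (forall u, 0 < degree 1 u) ->
  (forall u, ~~ ((\sum_(x | cl x == c) has_arc 1 u x == degree 1 u) &&
                 (\sum_(x | cl x == c) has_arc 2 u x < degree 2 u))) ->
  lost.
Proof.
move=> cc cy deg stuck; split; first exact: (inhabits (inl y)).
pose X := [set v : vertex G | match v with
  | inl x => cl x != c
  | inr u => [exists x, (cl x != c) && has_arc 1 u x] end].
apply: (@trap_Win1 _ X (inl c)); first by rewrite inE cc eqxx.
- move=> [x|//] [x'|u]; rewrite inE => xc _ xu; first by have := edge_owner xu.
  rewrite inE; have := stuck u; rewrite negb_and => /orP[ne|].
    have : 0 < \sum_(x | cl x != c) has_arc 1 u x.
      rewrite lt0n; apply: contra ne => /eqP E.
      by rewrite /degree (sum_split (fun x => cl x == c)) E addn0.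
    by case/sum_gt0P => x' x'c ux'; apply/existsP; exists x'; rewrite x'c.
  rewrite /degree (sum_split (fun x => cl x == c)) -[X in _ < X]addn0.
  rewrite -leqNgt addn0 -[X in _ <= X]addn0 leq_add2l leqNgt.
  by case/negP; apply/sum_gt0P; exists x.
- move=> [//|u] v; rewrite inE => /existsP[x /andP[xc ux]] _ _.
  by exists (inl x); rewrite ?inE.
- move=> f _ won; have [i _ fi] := won (inl y) 0.
  by exists i; rewrite fi inE.
Qed.

End Losing.

Section Decoding.
Variable T : finType.
Definition code (x : T) : nat := enum_rank x.

Lemma code_lt x : code x < #|T|.
Proof. exact: ltn_ord. Qed.

Lemma code_inj : injective code.
Proof. by move=> x y /val_inj/enum_rank_inj. Qed.

Lemma code_eq x y : (code x == code y) = (x == y).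
Proof. exact: inj_eq code_inj x y. Qed.

Lemma code_surj i : i < #|T| -> exists x, code x = i.
Proof.
by move=> lt; exists (enum_val (Ordinal lt)); rewrite /code enum_valK.
Qed.

End Decoding.

(** * The invariant of the contraction loop *)

Section Link.
Variables (G : game) (w m N : nat).
Notation n0 := #|V0 G|.
Notation n1 := #|V1 G|.
Hypothesis row_long : n0 + n1 + 2 * m + 4 <= N.
Hypothesis words_long : (2 * n0 + 4) * N <= 2 ^ w.
Implicit Types (s : state) (x y b c z : V0 G) (u : V1 G) (r : seq (V0 G)).

Notation tab := (tab N).
Notation sizes := (has_sizes n0 n1 m N).
Notation below s c := (tab s (2 * n0 + 3) (code c)).

(** The list [r] holds the classes under [c], from the top down; forcing goes from each class to the
    one below it. *)
Fixpoint stack_ok s c r : Prop :=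
  if r is b :: r' then
    [/\ below s c = (code b).+1, forces (inl c : vertex G) (inl b)
      & stack_ok s b r']
  else True.

Lemma stack_ok_frame s s' c r :
  (forall z, z \in c :: r -> below s' z = below s z) ->
  stack_ok s c r -> stack_ok s' c r.
Proof.
elim: r c => //= b r IHr c E [H1 H2 H3]; split=> //.
  by rewrite E ?mem_head.
by apply: IHr H3 => z zr; apply: E; rewrite inE zr orbT.
Qed.

Lemma stack_forces s c r z : stack_ok s c r -> z \in c :: r ->
  forces (inl c : vertex G) (inl z).
Proof.
elim: r c => [|b r IHr] c /=.
  by rewrite inE => _ /eqP ->; exact: forces_refl.
case=> _ cb /IHr H; rewrite inE => /predU1P[->|/H]; first exact: forces_refl.
exact: forces_trans.
Qed.

(** The map [cl] sends a vertex to the representative of its class. The condition [below_mem] speaks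
    of representatives only, because a merge leaves a stale entry behind for the absorbed class. *)
Record contracted cl c r s : Prop := Contracted {
  sizes_ok : sizes s;
  top_ok : regs s rTop = code c;
  cl_idem : forall x, cl (cl x) = cl x;
  cl_forces : forall x, forces (inl x : vertex G) (inl (cl x)) /\
                        forces (inl (cl x) : vertex G) (inl x);
  rows_ok : forall d y u, 0 < d <= 2 ->
    tab s (2 * code y + d) (code u) = \sum_(x | cl x == y) has_arc d u x;
  totals_ok : forall d u, 0 < d <= 2 ->
    tab s (2 * n0 + d) (code u) = degree d u;
  classes_ok : regs s rClasses = #|[set x | cl x == x]|;
  stack_uniq : uniq (c :: r);
  stack_cl : forall y, y \in c :: r -> cl y = y;
  below_mem : forall y, cl y = y -> (below s y != 0) = (y \in c :: r);
  below_lt : forall y, below s y <= n0;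
  chain_ok : stack_ok s c r
}.

(* A push lengthens the stack, a merge removes one class and one element of
   the stack, which consists of classes: so at most 2 #|V0| steps are made. *)
Definition potential (cl : V0 G -> V0 G) r := 2 * #|[set x | cl x == x]| - (size r).+1.

Lemma sum_arc_le (P : pred (V0 G)) d u : \sum_(x | P x) has_arc d u x <= n0.
Proof.
apply: leq_trans (_ : \sum_(x : V0 G) 1 <= _); last by rewrite sum1_card.
rewrite big_mkcond; apply: leq_sum => x _; case: (P x) => //; exact: leq_b1.
Qed.

(** The stack is a duplicate-free list of representatives. This keeps the subtraction in [potential]
    from truncating. *)
Lemma stack_size cl c r s : contracted cl c r s ->
  (size r).+1 <= #|[set x | cl x == x]|.
Proof.
case=> *; rewrite -[(size r).+1]/(size (c :: r)) -(card_uniqP _) //.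
by apply/subset_leq_card/subsetP => y yr; rewrite inE; apply/eqP; eauto.
Qed.

Lemma forced_class cl c r s u : contracted cl c r s -> positive_degrees G ->
  forced_from_outside n0 N s (code c) (code u) ->
  exists2 y, cl y != c & has_arc 2 u y.
Proof.
move=> I _ /andP[_]; rewrite (rows_ok I) // (totals_ok I) // /degree.
rewrite (sum_split (fun x => cl x == c)) -[X in X < _]addn0 ltn_add2l.
by case/sum_gt0P => y ? ?; exists y.
Qed.

(* A token in a predecessor of u is forced into the class c via u. *)
Lemma forced_forces cl c r s u y : contracted cl c r s -> positive_degrees G ->
  forced_from_outside n0 N s (code c) (code u) -> has_arc 2 u y ->
  forces (inl (cl y) : vertex G) (inl c).
Proof.
move=> I pos /andP[]; rewrite (rows_ok I) // (totals_ok I) // /degree => E _ yu.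
have [_ Fy] := cl_forces I y; apply: forces_trans Fy _.
apply: forces_trans (forces_move0 (y := inr u) _ yu) _ => //.
apply: forces_move1 => //.
  have [/degree_gt0P[x ux] _] := pos u => D.
  by move: ux; rewrite /has_arc /= (negPf (D _)).
move=> [x|u'] ux; last by have := edge_owner ux.
have [+ _] := cl_forces I x; suff -> : cl x = c by [].
(* A successor of [u] outside the class would make the entry for [c] smaller than the out-degree of
   [u]. *)
apply/eqP; apply: contraTT E => xc.
rewrite (sum_split (fun x => cl x == c)) -[X in X == _]addn0 eqn_add2l.
rewrite eq_sym -lt0n; apply/sum_gt0P; by exists x.
Qed.

(** Rows of vertices that represent no class are empty sums, so the class found by the search is a
    genuine representative. *)
Lemma row_gt0 cl c r s y u : contracted cl c r s ->
  0 < tab s (2 * code y + 2) (code u) ->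
  cl y = y /\ exists2 x, cl x = y & has_arc 2 u x.
Proof.
move=> I; rewrite (rows_ok I) // => /sum_gt0P[x /eqP xy ux].
by split; [rewrite -xy (cl_idem I)|exists x].
Qed.

Lemma contracted_push cl c r s s' u y : contracted cl c r s ->
  positive_degrees G -> forced_from_outside n0 N s (code c) (code u) -> y != c ->
  0 < tab s (2 * code y + 2) (code u) -> below s y = 0 ->
  sizes s' -> regs s' rTop = code y -> regs s' rClasses = regs s rClasses ->
  (forall j t : nat, t < N -> tab s' j t =
     if (t == code y) && (j == 2 * n0 + 3) then code c + 1 else tab s j t) ->
  contracted cl y (c :: r) s'.
Proof.
move=> I pos forced yc yu off sz' top' classes' T.
have [yy [x xy ux]] := row_gt0 I yu.
have ltN0 z : code z < N by have := code_lt z; lia.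
have ltN1 (v : V1 G) : code v < N by have := @code_lt (V1 G) v; lia.
have y_off : y \notin c :: r by rewrite -(below_mem I yy) off.
have Tbelow z : below s' z = if z == y then (code c).+1 else below s z.
  by rewrite T // code_eq eqxx andbT addn1.
have Trow j (v : V1 G) : j <= 2 * n0 + 2 -> tab s' j (code v) = tab s j (code v).
  by move=> lt; rewrite T // (_ : (j == _) = false) ?andbF //; lia.
split=> //.
- exact: cl_idem I.
- exact: cl_forces I.
- move=> d z v d2; rewrite -(rows_ok I) // Trow //.
  by have := code_lt z; lia.
- by move=> d v d2; rewrite -(totals_ok I) // Trow //; lia.
- by rewrite classes' (classes_ok I).
- by rewrite cons_uniq y_off (stack_uniq I).
- by move=> z; rewrite inE => /predU1P[-> //|]; exact: stack_cl I z.
- move=> z zz; rewrite Tbelow inE; have [E|_] := eqVneq z y => //.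
  by rewrite (below_mem I zz).
- move=> z; rewrite Tbelow; case: eqP => _; first exact: code_lt.
  exact: below_lt I z.
- rewrite /=; split; first by rewrite Tbelow eqxx.
    by rewrite -xy; exact: forced_forces I pos forced ux.
  apply: stack_ok_frame (chain_ok I) => z zr; rewrite Tbelow.
  by case: eqP => // E; rewrite -E zr in y_off.
Qed.

(** As [y] is on the stack and differs from [c], it is [b] or lies below it. Hence [b] forces [y],
    which forces [c] through [u]; since [c] forces [b] by the stack, the two classes may be
    united. *)
Lemma contracted_merge cl c b r s s' u y : contracted cl c (b :: r) s ->
  positive_degrees G -> forced_from_outside n0 N s (code c) (code u) -> y != c ->
  0 < tab s (2 * code y + 2) (code u) -> below s y != 0 ->
  sizes s' -> regs s' rTop = code b ->
  regs s' rClasses = (regs s rClasses).-1 ->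
  (forall j t : nat, t < N -> tab s' j t =
     if (t < n1) && ((j == 2 * code b + 1) || (j == 2 * code b + 2))
     then tab s j t + tab s (j + 2 * code c - 2 * code b) t
     else if (t < n1) && ((j == 2 * code c + 1) || (j == 2 * code c + 2)) then 0
     else tab s j t) ->
  let cl' := fun x => if cl x == c then b else cl x in
  contracted cl' b r s' /\
  [set x | cl' x == x] = [set x | cl x == x] :\ c.
Proof.
move=> I pos forced yc yu on sz' top' classes' T cl'.
have [yy [x xy ux]] := row_gt0 I yu.
have ltN0 z : code z < N by have := code_lt z; lia.
have ltN1 (v : V1 G) : code v < N by have := @code_lt (V1 G) v; lia.
have ltn1 (v : V1 G) : code v < n1 := @code_lt (V1 G) v.
have := stack_uniq I; rewrite cons_uniq inE negb_or => /andP[/andP[cb cr] br].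
have ccl : cl c = c by apply: (stack_cl I); rewrite mem_head.
have bcl : cl b = b by apply: (stack_cl I); rewrite !inE eqxx orbT.
have [_ Fcb ok_b] := chain_ok I.
have Fbc : forces (inl b : vertex G) (inl c).
  have : y \in b :: r.
    by have := on; rewrite (below_mem I yy) inE (negPf yc).
  move/(stack_forces ok_b) => Fby; apply: forces_trans Fby _.
  by rewrite -xy; exact: forced_forces I pos forced ux.
have bc : b != c by rewrite eq_sym.
have codebc : code b != code c by rewrite code_eq.
have Tbelow z : below s' z = below s z.
  have ltb := code_lt b; have ltc := code_lt c.
  rewrite T //; do 4![rewrite (_ : (2 * n0 + 3 == _) = false); last by lia].
  by rewrite !andbF.
have eq_classes : [set x | cl' x == x] = [set x | cl x == x] :\ c.
  apply/setP => z; rewrite !inE /cl'; have [zc|zc] := eqVneq (cl z) c.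
    rewrite zc (eq_sym c) andNb; apply/negP => /eqP E.
    by rewrite -E bcl in zc; rewrite zc eqxx in bc.
  case: (eqVneq z c) => [E|] //=; by rewrite E ccl eqxx in zc.
split=> //; split=> //.
- move=> z; rewrite /cl'; have [zc|zc] := eqVneq (cl z) c.
    by rewrite bcl (negPf bc).
  by rewrite (cl_idem I) (negPf zc).
- move=> z; have := cl_forces I z; rewrite /cl'; case: eqP => // -> [Fzc Fcz].
  by split; [exact: forces_trans Fzc Fcb|exact: forces_trans Fbc Fcz].
- move=> d z v d2.
  have Ezc : \sum_(x | cl' x == z) has_arc d v x =
      if z == b then \sum_(x | cl x == b) has_arc d v x + \sum_(x | cl x == c) has_arc d v x
      else if z == c then 0 else \sum_(x | cl x == z) has_arc d v x.
    case: eqP => [->|/eqP zb].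
      rewrite (bigID (fun x => cl x == c)) addnC /=; congr (_ + _).
        apply: eq_bigl => t; rewrite /cl'; case: (eqVneq (cl t) c) => /=.
          by rewrite eqxx.
        by rewrite andbF.
      apply: eq_bigl => t; rewrite /cl'; case: (eqVneq (cl t) c) => [->|] //=.
        by rewrite andbF eq_sym (negPf bc).
      by rewrite andbT.
    case: eqP => [->|/eqP zc].
      rewrite big_pred0 // => t; rewrite /cl'.
      by case: (eqVneq (cl t) c) => [_|/negPf]; rewrite ?(negPf bc).
    apply: eq_bigl => t; rewrite /cl'; case: (eqVneq (cl t) c) => [->|] //.
    by rewrite eq_sym (negPf zb) eq_sym (negPf zc).
  rewrite Ezc -!(rows_ok I) // T // ltn1 /=.
  have eqF (p q : nat) : p <> q -> (p == q) = false by move/eqP/negPf.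
  have [->|zb] := eqVneq z b.
    have -> : (2 * code b + d == 2 * code b + 1) || (2 * code b + d == 2 * code b + 2) by lia.
    by congr (_ + tab s _ _); lia.
  have zb' : code z != code b by rewrite code_eq.
  have -> : (2 * code z + d == 2 * code b + 1) || (2 * code z + d == 2 * code b + 2) = false by lia.
  have [->|zc] := eqVneq z c.
    by have -> : (2 * code c + d == 2 * code c + 1) || (2 * code c + d == 2 * code c + 2) by lia.
  have zc' : code z != code c by rewrite code_eq.
  by have -> : (2 * code z + d == 2 * code c + 1) || (2 * code z + d == 2 * code c + 2) = false by lia.
- move=> d v d2; rewrite -(totals_ok I) // T // ltn1 /=.
  have ltb := code_lt b; have ltc := code_lt c.
  by do 4![rewrite (_ : (2 * n0 + d == _) = false); last by lia].
- rewrite eq_classes classes' (classes_ok I) (cardsD1 c [set x | _]) inE ccl eqxx.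
  by [].
- move=> z zr; rewrite /cl'; rewrite (stack_cl I); last by rewrite inE zr orbT.
  case: eqP => // E; move: zr; rewrite E inE (negPf cb) /=.
  by move=> H; rewrite H in cr.
- move=> z; rewrite /cl' Tbelow; have [zc|zc] := eqVneq (cl z) c => E.
    by rewrite -E bcl in zc; rewrite zc eqxx in bc.
  rewrite (below_mem I E) inE; case: eqP => // zc'.
  by rewrite zc' ccl eqxx in zc.
- by move=> z; rewrite Tbelow; exact: below_lt I z.
- by apply: stack_ok_frame ok_b => z _; exact: Tbelow.
Qed.

(** All vertices of [V0 G] force one another. A vertex of [V1 G] can only move into [V0 G] and has a
    predecessor there, so all pairs of vertices are covered. *)
Lemma one_class_Win0 (cl : V0 G -> V0 G) : n0 <= n1 -> positive_degrees G ->
  (forall x, cl (cl x) = cl x) ->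
  (forall x, forces (inl x : vertex G) (inl (cl x)) /\
             forces (inl (cl x) : vertex G) (inl x)) ->
  #|[set x | cl x == x]| <= 1 -> forall v : vertex G, Win false v.
Proof.
move=> n01 pos idem F one.
have F0 x y : forces (inl x : vertex G) (inl y).
  have E : cl x = cl y.
    by apply: (card_le1_eqP one); rewrite inE idem.
  by have [Fx _] := F x; have [_ Fy] := F y; rewrite E in Fx; apply: forces_trans Fx Fy.
have out u : ~ dead_end (inr u : vertex G).
  have [/degree_gt0P[x ux] _] := pos u => D.
  by have /negP := D (inl x); apply.
have F1 (v : vertex G) y : forces v (inl y).
  case: v => [x|u]; first exact: F0.
  apply: forces_move1 => // -[x|u'] e; first exact: F0.
  by have := edge_owner e.
apply: forces_all_Win0.
  move=> v [y|u]; first exact: F1.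
  have [_ /degree_gt0P[x xu]] := pos u.
  by apply: forces_trans (F1 v x) _; apply: forces_move0.
move=> [x|u]; last exact: out.
(* To see that [x] is no dead end, take a predecessor [y] of any [u]: either [x] is [y], or [x] has
   to move in order to force a visit to [y]. *)
have [u _] : exists u : V1 G, true.
  have /card_gt0P[u _] : 0 < #|V1 G| by have := code_lt x; lia.
  by exists u.
have [_ /degree_gt0P[y yu]] := pos u.
have [E|ne] := eqVneq x y; first by move=> D; have /negP := D (inr u); rewrite E; apply.
have /forces_edge[|v xv] := F0 x y; first by apply: contraNneq ne => -[->].
by move=> D; have /negP := D v; apply.
Qed.

Definition decided s :=
  (regs s rOk = 0 /\ lost G) \/
  (regs s rOk = 1 /\ forall v : vertex G, Win false v).

(** The case of empty [V0] is separate because [contracted] needs a class on top of the stack. *)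
Definition loop_invariant k s := sizes s /\
  ((regs s rOk = 0 /\ lost G) \/
   [/\ regs s rOk = 1, positive_degrees G
     & (n0 = 0 /\ regs s rClasses = 0) \/
       exists cl c r, contracted cl c r s /\ potential cl r <= k]).

Lemma contract_step_invariant k s : loop_invariant k s ->
  regs s rOk = 1 -> 1 < regs s rClasses ->
  run w contract_step s (100 + (n0 + n1) * 300) (fun s' =>
    exists2 l, l < k & loop_invariant l s').
Proof.
move=> [sz I] ok1 many; case: I => [[]|[_ pos]]; first by rewrite ok1.
case=> [[_ E]|[cl [c [r [I small]]]]]; first by rewrite E in many.
have W := row_fits row_long words_long.
have pot := stack_size I.
have classes := classes_ok I.
have r_cons y u : forced_from_outside n0 N s (code c) (code u) -> y != c ->
    0 < tab s (2 * code y + 2) (code u) -> below s y != 0 ->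
    exists b r', r = b :: r'.
  move=> fu yc yu; have [yy _] := row_gt0 I yu.
  rewrite (below_mem I yy) inE (negPf yc) /=.
  by case: (r) => // b r' _; exists b, r'.
eapply run_weaken.
  apply: (run_contract_step row_long words_long sz (top_ok I) (code_lt c)).
  - move=> i /code_surj[u <-] fu.
    have [y yc uy] := forced_class I pos fu.
    exists (code (cl y)); split; first exact: code_lt.
      by rewrite code_eq.
    by rewrite (rows_ok I) //; apply/sum_gt0P; exists y.
  - move=> i j /code_surj[u <-] fu /code_surj[y <-]; rewrite code_eq => yc yu on.
    have [b [r' Er]] := r_cons _ _ fu yc yu on.
    have := chain_ok I; rewrite Er => -[-> _ _] /=.
    split; first exact: code_lt.
    have := stack_uniq I; rewrite Er code_eq /= inE negb_or eq_sym.
    by case/andP => /andP[].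
  - move=> d i j1 j2 d2 /code_surj[u <-] /code_surj[c1 <-] /code_surj[c2 <-] _.
    rewrite !(rows_ok I) //.
    have := sum_arc_le (fun x => cl x == c1) d u.
    by have := sum_arc_le (fun x => cl x == c2) d u; lia.
  - by have := below_lt I c; lia.
  - have : #|[set x | cl x == x]| <= n0 by exact: max_card.
    by rewrite classes; lia.
move=> s' [sz' step]; case: step => [M ok0 none|j i|j i].
(* The answer 0 ends the loop, so any smaller index will do; [k] is positive because at least two
   classes remain. *)
- exists 0; first by move: small; rewrite /potential; lia.
  split=> //; left; split=> //.
  have ccl : cl c = c by apply: (stack_cl I); rewrite mem_head.
  have [y yc] : exists y, cl y != c.
    have : 0 < #|[set x | cl x == x] :\ c|.
      by rewrite classes (cardsD1 c) inE ccl eqxx in many; lia.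
    by case/card_gt0P => y; rewrite !inE => /andP[yc /eqP E]; exists y; rewrite E.
  apply: (lost_stuck ccl yc) => [u|u]; first by have [] := pos u.
  have := none _ (code_lt u).
  by rewrite /forced_from_outside !(rows_ok I) // !(totals_ok I).
- move=> /code_surj[u <-] fu /code_surj[y <-]; rewrite code_eq => yc yu off ok t cls T.
  have I' := contracted_push I pos fu yc yu off sz' t cls T.
  exists (potential cl (c :: r)).
    by have := stack_size I'; move: small; rewrite /potential /=; lia.
  split=> //; right; split=> //; first by rewrite ok.
  by right; exists cl, y, (c :: r).
- move=> /code_surj[u <-] fu /code_surj[y <-]; rewrite code_eq => yc yu on ok t cls T.
  have [b [r' Er]] := r_cons _ _ fu yc yu on; rewrite {r}Er in I small pot {r_cons} *.
  have [Eb _ _] := chain_ok I.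
  rewrite Eb /= in t T.
  have [I' E] := contracted_merge I pos fu yc yu on sz' t cls T.
  have ccl : cl c = c by apply: (stack_cl I); rewrite mem_head.
  eexists (potential _ r'); last first.
    split=> //; right; split=> //; first by rewrite ok.
    by right; do 3!eexists; split; first exact: I'.
  have := stack_size I'; move: small pot; rewrite /potential E /=.
  by rewrite (cardsD1 c [set x | _]) inE ccl eqxx; lia.
Qed.

Lemma run_contract s (ok : bool) : n0 <= n1 -> sizes s -> regs s rOk = ok ->
  (if ok then positive_degrees G else lost G) ->
  (forall d c u, 0 < d <= 2 -> tab s (2 * code c + d) (code u) = has_arc d u c) ->
  (forall d u, 0 < d <= 2 -> tab s (2 * n0 + d) (code u) = degree d u) ->
  (forall i, i < N -> tab s (2 * n0 + 3) i = 0) ->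
  run w contract s (100 + n0 * (600 * (n0 + n1) + 300)) decided.
Proof.
move=> n01 sz Eok okP rows totals zero; have W := row_fits row_long words_long.
have [E0 E1 EE EN] := sz.
eapply run_le; first eapply run_seq.
  eapply run_assign => //.
  eapply run_seq; eapply run_assign => //; first by rewrite /=; lia.
  eapply run_seq; eapply run_write.
  - rewrite /= /upd /= E0 EN addn0.
    have := cell_fits row_long words_long (leqnn (2 * n0 + 3)) (x := 0).
    by repeat split=> //; lia.
  - by rewrite /=; lia.
  eapply (run_while (I := loop_invariant) (n := 2 * n0)).
  - move=> k s1 [_ I]; rewrite /=.
    have ok1 : regs s1 rOk <= 1 by case: I => [[->]|[->]].
    by repeat split=> //; lia.
  - move=> k s1 I /=; rewrite muln_eq0 negb_or eqb0 negbK => /andP[ok1 many].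
    apply: contract_step_invariant => //.
    by case: I => _ [[E]|[]] //; rewrite E in ok1.
  - move=> k s1 [sz1 I] /= /eqP.
    case: I => [[E l] _|[E pos H]]; first by left.
    rewrite E mul1n eqb0 -leqNgt => few; right; split=> //.
    case: H => [[n00 _]|[cl [c [r [I _]]]]].
      apply: (one_class_Win0 (cl := id)) => // [x|]; first by split; exact: forces_refl.
      by apply: leq_trans (max_card _) _; rewrite n00.
    apply: one_class_Win0 (cl_idem I) (cl_forces I) _ => //.
    by rewrite -(classes_ok I).
  rewrite /= /upd /= E0 EN addn0.
  split; first by [].
  move: okP; rewrite /= Eok; case: (ok) => okP; [right|left] => //.
  split=> //; have [n00|n0_gt0] := posnP n0; [by left|right].
  (* The program starts its stack with the vertex numbered 0; initially every vertex is a class of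
     its own. *)
  have [c Ec] := code_surj n0_gt0.
  have Trow j i : j <= 2 * n0 + 2 -> i < N ->
      tab (State (regs s) (upd (mem s) ((2 * n0 + 3) * N) 1)) j i = tab s j i.
    move=> lej ltN; rewrite /tab /= -[(2 * n0 + 3) * N]addn0 upd_cell //; last lia.
    by rewrite (_ : (j == _) = false) ?andbF //; lia.
  exists id, c, [::]; split; last first.
    apply: leq_trans (leq_subr _ _) _.
    by rewrite leq_mul2l; exact: max_card.
  have Tbelow y : below (State (regs s) (upd (mem s) ((2 * n0 + 3) * N) 1)) y = (y == c).
    have ltN : code y < N by have := code_lt y; lia.
    have := @upd_cell N (mem s) (2 * n0 + 3) (2 * n0 + 3) (code y) 0 1.
    rewrite addn0 eqxx andbT (_ : (code y == 0) = (y == c)); last by rewrite -code_eq Ec.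
    rewrite /tab /= => -> //; last lia.
    by case: eqP => //= _; have := zero _ ltN; rewrite /tab => ->.
  split=> //=.
  - by move=> x; split; exact: forces_refl.
  - move=> d y u d2; have ltN : code u < N by have := code_lt u; lia.
    have le : 2 * code y + d <= 2 * n0 + 2 by have := code_lt y; lia.
    have := Trow _ _ le ltN; rewrite [in X in _ = X -> _]rows //.
    by rewrite /tab /upd /= => ->; rewrite big_pred1_eq.
  - move=> d u d2; have ltN : code u < N by have := code_lt u; lia.
    have le : 2 * n0 + d <= 2 * n0 + 2 by lia.
    have := Trow _ _ le ltN; rewrite [in X in _ = X -> _]totals //.
  - by rewrite -[LHS]cardsT; apply: eq_card => x; rewrite !inE /= eqxx.
  - by move=> y _; have := Tbelow y; rewrite /tab /upd /= => ->; rewrite inE; case: (y == c).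
  - by move=> y; have := Tbelow y; rewrite /tab /upd /= => ->; case: (y == c).
by rewrite /=; nia.
Qed.

End Link.

Lemma sum_eq_mem (T : finType) (A : {set T}) t : \sum_(e in A) (e == t) = (t \in A).
Proof.
case: (boolP (t \in A)) => [tA|tA].
  by rewrite (bigD1 t) //= eqxx big1 // => e /andP[_ /negPf ->].
by rewrite big1 // => e eA; case: eqP => // E; rewrite -E eA in tA.
Qed.

Lemma nth_flatten_pairs (T : Type) (f g : T -> nat) (es : seq T) i :
  nth 0 (flatten [seq [:: f e; g e] | e <- es]) (2 * i) = nth 0 (map f es) i /\
  nth 0 (flatten [seq [:: f e; g e] | e <- es]) (2 * i).+1 = nth 0 (map g es) i.
Proof.
elim: es i => [|e es IHes] [|i]; rewrite ?mulnS ?nth_nil /= ?nth_nil //; exact: IHes.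
Qed.

(** * From the edge list to the table of edge counts *)

Section Input.
Variables (G : game) (es : seq (vertex G * vertex G)).
Hypothesis es_edges : perm_eq es (enum (edges G)).
Notation n0 := #|V0 G|.
Notation n1 := #|V1 G|.
Notation m := (size es).
Implicit Types (x c : V0 G) (u : V1 G) (e : vertex G * vertex G).

Definition edge_code e := (vertex_code e.1, vertex_code e.2).

Lemma size_edges : m = #|edges G|.
Proof. by rewrite (perm_size es_edges) cardE. Qed.

Definition arc_pair d u x : vertex G * vertex G :=
  if d == 1 then (inr u, inl x) else (inl x, inr u).

Lemma has_arcE d u x : has_arc d u x = (arc_pair d u x \in edges G).
Proof. by rewrite /has_arc /arc_pair; case: ifP. Qed.

Variant edge_cases e : Prop :=
| Edge01 x u of e = (inl x, inr u)
| Edge10 u x of e = (inr u, inl x).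

Lemma edgeP e : e \in edges G -> edge_cases e.
Proof.
case: e => -[x|u] [y|v] /edges_bipartite //= _.
- exact: (Edge01 (x := x) (u := v)).
- exact: (Edge10 (u := u) (x := y)).
Qed.

Lemma edge_code01 x u : edge_code (inl x, inr u) = (code x, n0 + code u).
Proof. by []. Qed.

Lemma edge_code10 x u : edge_code (inr u, inl x) = (n0 + code u, code x).
Proof. by []. Qed.

(** The row of a class differs from the degree row because [code c < n0], and from rows for the
    other direction by parity. *)
Lemma contribution_row e d c u : e \in edges G -> 0 < d <= 2 ->
  contribution n0 (edge_code e) (2 * code c + d) (code u) = (e == arc_pair d u c).
Proof.
move=> eE d2; have cn := code_lt c; have d12 : d = 1 \/ d = 2 by lia.
rewrite /contribution /arc_pair; case: (edgeP eE) => [x v|v x] ->.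
  rewrite edge_code01 /= code_lt addKn code_eq.
  rewrite (_ : (_ == 2 * n0 + 2) = false) ?addn0; last by lia.
  case: d12 => -> /=; rewrite ?xpair_eqE /=.
    by rewrite (_ : (_ == _ + 2) = false) ?muln0 //; lia.
  by rewrite eqn_add2r eqn_mul2l code_eq mulnb (eq_sym c) (eq_sym u) andbC.
rewrite edge_code10 /= ltnNge leq_addr /= addKn code_eq.
rewrite (_ : (_ == 2 * n0 + 1) = false) ?addn0; last by lia.
case: d12 => -> /=; rewrite ?xpair_eqE /=; last first.
  by rewrite (_ : (_ == _ + 1) = false) ?muln0 //; lia.
by rewrite eqn_add2r eqn_mul2l code_eq mulnb (eq_sym u) (eq_sym c).
Qed.

Lemma contribution_total e d u : e \in edges G -> 0 < d <= 2 ->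
  contribution n0 (edge_code e) (2 * n0 + d) (code u) =
  \sum_x (e == arc_pair d u x).
Proof.
move=> eE d2; have d12 : d = 1 \/ d = 2 by lia.
rewrite /contribution /arc_pair; case: (edgeP eE) => [x v|v x] ->.
  have xn := code_lt x; have nx : (2 * n0 + d == 2 * code x + 2) = false by lia.
  rewrite edge_code01 /= xn addKn code_eq nx add0n.
  case: d12 => -> /=; rewrite ?eqxx.
    by rewrite big1 // (_ : (_ == _ + 2) = false) ?muln0 //; lia.
  rewrite (bigD1 x) //= big1 ?addn0 => [|y /negPf ne].
    by rewrite xpair_eqE eqxx muln1 eq_sym.
  by rewrite xpair_eqE; have -> : (inl x == inl y :> vertex G) = false by rewrite -ne eq_sym.
have xn := code_lt x; have nx : (2 * n0 + d == 2 * code x + 1) = false by lia.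
rewrite edge_code10 /= ltnNge leq_addr /= addKn code_eq nx add0n.
case: d12 => -> /=; rewrite ?eqxx; last first.
  by rewrite big1 // (_ : (_ == _ + 1) = false) ?muln0 //; lia.
rewrite (bigD1 x) //= big1 ?addn0 => [|y /negPf ne].
  by rewrite xpair_eqE eqxx andbT muln1 eq_sym.
by rewrite xpair_eqE andbC; have -> : (inl x == inl y :> vertex G) = false by rewrite -ne eq_sym.
Qed.

(** The row describing the stack lies beyond all counted rows, so it is still zero when the
    contraction starts. *)
Lemma contribution_below e i : e \in edges G ->
  contribution n0 (edge_code e) (2 * n0 + 3) i = 0.
Proof.
move=> eE; rewrite /contribution; case: (edgeP eE) => [x v|v x] ->;
  have xn := code_lt x.
  have f1 : (2 * n0 + 3 == 2 * code x + 2) = false by lia.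
  have f2 : (2 * n0 + 3 == 2 * n0 + 2) = false by lia.
  by rewrite edge_code01 /= xn f1 f2 muln0.
have f1 : (2 * n0 + 3 == 2 * code x + 1) = false by lia.
have f2 : (2 * n0 + 3 == 2 * n0 + 1) = false by lia.
by rewrite edge_code10 /= ltnNge leq_addr /= f1 f2 muln0.
Qed.

Lemma sum_edge_code (F : nat * nat -> nat) :
  \sum_(p <- map edge_code es) F p = \sum_(e in edges G) F (edge_code e).
Proof. by rewrite big_map (perm_big _ es_edges) big_enum. Qed.

Lemma sum_row d c u : 0 < d <= 2 ->
  \sum_(p <- map edge_code es) contribution n0 p (2 * code c + d) (code u) =
  has_arc d u c.
Proof.
move=> d2; rewrite sum_edge_code has_arcE -sum_eq_mem.
by apply: eq_bigr => e eE; exact: contribution_row.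
Qed.

Lemma sum_total d u : 0 < d <= 2 ->
  \sum_(p <- map edge_code es) contribution n0 p (2 * n0 + d) (code u) =
  degree d u.
Proof.
move=> d2; rewrite sum_edge_code /degree.
rewrite (eq_bigr (fun e => \sum_x (e == arc_pair d u x))).
  by rewrite exchange_big; apply: eq_bigr => x _; rewrite sum_eq_mem has_arcE.
by move=> e eE; exact: contribution_total.
Qed.

Lemma sum_below i :
  \sum_(p <- map edge_code es) contribution n0 p (2 * n0 + 3) i = 0.
Proof.
by rewrite sum_edge_code big1 // => e eE; exact: contribution_below.
Qed.

Lemma valid_codes : all (valid_edge n0 n1) (map edge_code es).
Proof.
apply/allP => p /mapP[e]; rewrite (perm_mem es_edges) mem_enum => eE ->.
rewrite /valid_edge; case: (edgeP eE) => [x v|v x] ->.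
  by rewrite edge_code01 /= code_lt leq_addr ltn_add2l code_lt.
by rewrite edge_code10 /= ltnNge leq_addr /= ltn_add2l !code_lt.
Qed.

Lemma input_word i : i < m ->
  nth 0 (input_words es) (2 * i + 3) = (nth (0, 0) (map edge_code es) i).1 /\
  nth 0 (input_words es) (2 * i + 4) = (nth (0, 0) (map edge_code es) i).2.
Proof.
move=> im; rewrite addn3 addn4 /input_words /=.
have [-> ->] := nth_flatten_pairs (fun e : vertex G * vertex G => vertex_code e.1)
  (fun e : vertex G * vertex G => vertex_code e.2) es i.
case: es im => // e0 es' im.
by rewrite !(nth_map e0).
Qed.

Lemma input_beyond i : 2 * m + 3 <= i -> nth 0 (input_words es) i = 0.
Proof.
move=> le; apply: nth_default; rewrite /input_words /= size_flatten sumnE !big_map /=.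
by rewrite big_const_seq count_predT iter_addn_0; move: le; rewrite addn3.
Qed.

Lemma run_solver w : word_size_ok G 4 w ->
  run w solver (initial_state es)
    (2000 * (#|edges G| + n1 ^ 2 + 1)) (@decided G).
Proof.
rewrite /word_size_ok -size_edges; set K := _ + 2 => wordsK.
pose N := 2 * (n0 + n1 + (m + 2)).
have row_long : n0 + n1 + 2 * m + 4 <= N by rewrite /N; lia.
have words_long : (2 * n0 + 4) * N <= 2 ^ w.
  apply: leq_trans wordsK; have -> : N = 2 * K by rewrite /N /K; lia.
  have : 2 * n0 + 4 <= 2 * K by rewrite /K; lia.
  have : 2 <= K by rewrite /K; lia.
  have -> : K ^ 4 = K * K * (K * K) by rewrite !expnS expn0; lia.
  (* As [K] is at least 2, [4 * K ^ 2] is at most [K ^ 4]; hence the exponent 4 in the word size. *)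
  move=> K2 le; apply: (@leq_trans (2 * K * (2 * K))); first by rewrite leq_mul.
  have : 4 <= K * K by apply: (@leq_mul 2 2).
  by nia.
have W := row_fits row_long words_long.
have [lt|n01] := ltnP n1 n0.
  eapply run_le; first eapply run_seq.
    eapply run_assign; first by rewrite /=; lia.
    eapply run_seq; eapply run_assign; first by rewrite /=; lia.
    eapply (run_if (T2 := 0)); first by rewrite /=; split=> //; lia.
      move=> _; apply: run_skip; left; split=> //; exact: lost_pigeonhole.
    by rewrite /= /upd /= lt.
  by rewrite /=; lia.
eapply run_le; first eapply run_seq.
  eapply run_assign; first by rewrite /=; lia.
  eapply run_seq; eapply run_assign; first by rewrite /=; lia.
  eapply (run_if (T1 := 0)); first by rewrite /=; split=> //; lia.
    by rewrite /= /upd /= ltnNge n01.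
  move=> _; rewrite /= /upd /=.
  have lenW : N < 2 ^ w by lia.
  have row_length_fits s : 2 * (regs s rN0 + regs s rN1 + (regs s rE + 2)) < 2 ^ w ->
      fits (2 ^ w) s row_length by rewrite /=; repeat split => //; lia.
  eapply run_seq; eapply run_assign; first by rewrite /=; lia.
  eapply run_seq; eapply run_assign.
    by apply: row_length_fits; exact: lenW.
  set s1 := State _ _.
  have sz1 : has_sizes n0 n1 m N s1 by [].
  have M1 : mem s1 = nth 0 (input_words es) by [].
  eapply run_seq; eapply run_weaken.
    apply: (run_read_edges row_long words_long sz1 (es := map edge_code es)).
    - by rewrite size_map.
    - by move=> i im; rewrite /tab M1 mul0n add0n; have [] := input_word im.
    - by move=> i im; rewrite /tab M1 mul0n add0n; have [] := input_word im.
    - exact: valid_codes.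
    (* The input ends within row 0 and memory is zero beyond it, so no time is spent on clearing the
       table. *)
    - by move=> j x j0 xN; rewrite /tab M1; apply: input_beyond; nia.
  move=> s2 [R2 T2].
  have sz2 : has_sizes n0 n1 m N s2 by split; rewrite R2.
  have ltN (u : V1 G) : code u < N by have := code_lt u; lia.
  have rows d c u : 0 < d <= 2 -> tab N s2 (2 * code c + d) (code u) = has_arc d u c.
    by move=> d2; rewrite T2 ?sum_row //; lia.
  have totals d u : 0 < d <= 2 -> tab N s2 (2 * n0 + d) (code u) = degree d u.
    by move=> d2; rewrite T2 ?sum_total //; lia.
  eapply run_seq; eapply run_weaken.
    exact: (run_check_degrees row_long words_long sz2).
  move=> s3 [R3 M3 [ok [Eok okP]]].
  have sz3 : has_sizes n0 n1 m N s3 by split; rewrite R3 // R2.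
  apply: (run_contract row_long words_long n01 sz3 Eok).
  - case: ok okP {Eok} => okP.
      move=> u; have [_ /(_ isT)/(_ _ (code_lt u))] := conj okP (iffLR okP).
      by rewrite !totals.
    have ex : [exists u : V1 G, ~~ ((0 < degree 1 u) && (0 < degree 2 u))].
      apply: contraT => /existsPn H; apply/okP => i /code_surj[u <-].
      by rewrite !totals //; apply/andP; apply/negPn; exact: H.
    case/existsP: ex => u.
    rewrite negb_and -!eqn0Ngt => /orP[] /eqP.
      exact: lost_isolated.
    exact: lost_isolated.
  - by move=> d c u d2; rewrite /tab M3; exact: rows.
  - by move=> d u d2; rewrite /tab M3; exact: totals.
  - move=> i iN; rewrite /tab M3; have := T2 (2 * n0 + 3) i; rewrite /tab => -> //; last lia.
    exact: sum_below.
(* Since |V_0| is at most |V_1|, every quadratic term is at most [b * b]; what remains is linear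
   arithmetic. *)
move: n01; clear; move: #|V0 G| #|V1 G| (size es) => a b c ab.
rewrite /= expnS expn1.
have : a * a <= b * b by rewrite leq_mul.
have : a * b <= b * b by rewrite leq_mul.
have : b <= b * b by case: (b) => // k; rewrite leq_pmulr.
by lia.
Qed.

End Input.

(** One player wins from everywhere, and [Win_exclusive] then refutes all wins of the other. *)
Lemma decided_solved (G : game) s : decided G s -> solved_by G s.
Proof.
move=> [[Es [[v0] W1]]|[Es W0]].
  exists false; split=> //; [move=> v|].
    by split=> // W0; case: (Win_exclusive W0 (W1 v)).
  by split=> // W0; case: (Win_exclusive (W0 v0) (W1 v0)).
exists true; split=> // v.
by split=> // /(Win_exclusive (W0 v)).
Qed.

Theorem theorem2 (R : realType) :
  exists (p : cmd) (k : nat) (C : R),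
    forall (G : game) (es : seq (vertex G * vertex G)) (w : nat),
      perm_eq es (enum (edges G)) ->
      word_size_ok G k w ->
      exists (t : nat) (s : state),
        [/\ exec w p (initial_state es) t s,
            solved_by G s
          & (t%:R <= C * ((Num.sqrt #|V1 G|%:R + 1) * #|edges G|%:R
                          + #|V1 G|%:R ^+ 2 + 1))%R].
Proof.
exists solver, 4, 2000%:R%R => G es w es_edges words.
have [t [s [run_s t_le dec]]] := run_solver es_edges words.
exists t, s; split=> //; first exact: decided_solved.
apply: (@le_trans _ _ (2000 * (#|edges G| + #|V1 G| ^ 2 + 1))%:R%R).
  by rewrite ler_nat.
(* The time found is linear in |E| + |V_1|^2 + 1, so the factor of |E| in the claim need only be at
   least 1. *)
rewrite natrM !natrD natrX ler_wpM2l ?ler0n // !lerD2r.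
by rewrite ler_peMl ?ler0n // lerDr Num.Theory.sqrtr_ge0.
Qed.
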